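(* Let $K$ be an infinite field of arbitrary characteristic, $R=K[[x_1,\ldots,x_s]]$ with maximal ideal $\mathfrak{m}=\langle x_1,\ldots,x_s\rangle$, and $M_{2,2}$ the set of $2\times 2$ matrices with entries in $R$. Let $A\in \mathfrak{m}\cdot M_{2,2}$. Then the following are equivalent: 1. $A$ is finitely $G$-determined. 2. $\dim_K M_{2,2}/\widetilde T_A(GA)<\infty$.
   Context: Let $G=\left(GL(2,R)\times GL(2,R)^{\mathrm{op}}\right)\rtimes \mathrm{Aut}(R)$, where $\mathrm{Aut}(R)$ is the group of $K$-algebra automorphisms of $R$. It acts on $M_{2,2}$ by $(U,V,\phi,A)\mapsto U\cdot\phi(A)\cdot V$, where $\phi(A)=[\phi(a_{ij})]=[a_{ij}(\phi(x_1),\ldots,\phi(x_s))]$ with $\phi(x_i)\in\mathfrak{m}$. Two matrices $A,B$ are $G$-equivalent if $B$ lies in the $G$-orbit $GA$ of $A$. A matrix $A$ is $G$ $k$-determined if every $B\in M_{2,2}$ with $B-A\in\mathfrak{m}^{k+1}\cdot M_{2,2}$ is $G$-equivalent to $A$; $A$ is finitely $G$-determined if it is $G$ $k$-determined for some positive integer $k$. The tangent image of $A$ is the $R$-submodule $\widetilde T_A(GA)=\langle E_{pq}\cdot A : p,q=1,2\rangle+\langle A\cdot E_{hl}: h,l=1,2\rangle+\mathfrak{m}\cdot\langle \partial A/\partial x_\nu : \nu=1,\ldots,s\rangle$ of $M_{2,2}$, where $E_{pq}$ is the $2\times2$ matrix with $1$ at position $(p,q)$ and $0$ elsewhere, $\partial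 A/\partial x_\nu$ is the entrywise partial derivative, and $\langle\cdot\rangle$ denotes the $R$-submodule generated. *)

(* Defs.v *)
From HB Require Import structures.
From mathcomp Require Import all_boot all_order all_algebra.
Set Implicit Arguments. Unset Strict Implicit. Unset Printing Implicit Defensive.
Import Order.TTheory GRing.Theory.
Local Open Scope ring_scope.

Section PowerSeries.
Variables (K : fieldType) (s : nat).

Definition mono := {ffun 'I_s -> nat}.
Definition mdeg (a : mono) : nat := (\sum_(i < s) a i)%N.
Definition mzero : mono := [ffun _ => 0%N].
Definition munit (i : 'I_s) : mono := [ffun j => (j == i)%N : nat].
Definition madd (a b : mono) : mono := [ffun i => (a i + b i)%N].
Definition msub (a b : mono) : mono := [ffun i => (a i - b i)%N].

Definition ps := mono -> K.

Definition ps_coefK (c : K) : ps := fun a => if a == mzero then c else 0.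
Definition ps0 : ps := ps_coefK 0.
Definition ps1 : ps := ps_coefK 1.
Definition ps_var (i : 'I_s) : ps := fun a => if a == munit i then 1 else 0.
Definition ps_add (f g : ps) : ps := fun a => f a + g a.
Definition ps_opp (f : ps) : ps := fun a => - f a.
Definition ps_sub (f g : ps) : ps := fun a => f a - g a.
Definition ps_scale (c : K) (f : ps) : ps := fun a => c * f a.
Definition ps_sum (I : finType) (F : I -> ps) : ps := fun a => \sum_(i : I) F i a.

Definition ord_to_mono n (b : {ffun 'I_s -> 'I_n}) : mono :=
  [ffun i => nat_of_ord (b i)].

Definition ps_mul (f g : ps) : ps := fun a =>
  \sum_(b : {ffun 'I_s -> 'I_(mdeg a).+1} | [forall i, (b i <= a i)%N])
     f (ord_to_mono b) * g (msub a (ord_to_mono b)).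

Definition ps_deriv (v : 'I_s) (f : ps) : ps := fun a =>
  (a v).+1%:R * f (madd a (munit v)).

(* the maximal ideal m = <x_1,...,x_s> : series with zero constant term *)
Definition in_m (f : ps) : Prop := f mzero = 0.

Fixpoint inlist (T : Type) (x : T) (l : seq T) : Prop :=
  if l is y :: l' then y = x \/ inlist x l' else False.

Fixpoint in_mpow (n : nat) (f : ps) : Prop :=
  match n with
  | 0 => True
  | n'.+1 => exists (l : seq (ps * ps)),
      (forall p, inlist p l -> in_m p.1 /\ in_mpow n' p.2) /\
      f = foldr (fun p acc => ps_add (ps_mul p.1 p.2) acc) ps0 l
  end.

Definition is_Kalg_aut (phi : ps -> ps) : Prop :=
  [/\ forall f g, phi (ps_add f g) = ps_add (phi f) (phi g),
      forall c f, phi (ps_scale c f) = ps_scale c (phi f),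
      forall f g, phi (ps_mul f g) = ps_mul (phi f) (phi g),
      phi ps1 = ps1 & bijective phi].

Definition M22 := 'M[ps]_2.

Definition mx_mul (A B : M22) : M22 :=
  \matrix_(i, j) ps_sum (fun k : 'I_2 => ps_mul (A i k) (B k j)).
Definition mx_add (A B : M22) : M22 := \matrix_(i, j) ps_add (A i j) (B i j).
Definition mx_sub (A B : M22) : M22 := \matrix_(i, j) ps_sub (A i j) (B i j).
Definition mx_rscale (r : ps) (A : M22) : M22 := \matrix_(i, j) ps_mul r (A i j).
Definition mx_Kscale (c : K) (A : M22) : M22 := \matrix_(i, j) ps_scale c (A i j).
Definition mx_sum (I : finType) (F : I -> M22) : M22 :=
  \matrix_(i, j) ps_sum (fun k => F k i j).
Definition mx_id : M22 := \matrix_(i, j) (if i == j then ps1 else ps0).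
Definition Epq (p q : 'I_2) : M22 :=
  \matrix_(i, j) (if (i == p) && (j == q) then ps1 else ps0).
Definition mx_map (phi : ps -> ps) (A : M22) : M22 := \matrix_(i, j) phi (A i j).
Definition mx_deriv (v : 'I_s) (A : M22) : M22 := \matrix_(i, j) ps_deriv v (A i j).

Definition in_GL2 (U : M22) : Prop :=
  exists V : M22, mx_mul U V = mx_id /\ mx_mul V U = mx_id.

Definition G_equiv (A B : M22) : Prop :=
  exists (U V : M22) (phi : ps -> ps),
    [/\ in_GL2 U, in_GL2 V, is_Kalg_aut phi &
        B = mx_mul (mx_mul U (mx_map phi A)) V].

Definition G_k_determined (k : nat) (A : M22) : Prop :=
  forall B : M22, (forall i j, in_mpow k.+1 (mx_sub B A i j)) -> G_equiv A B.

Definition G_finitely_determined (A : M22) : Prop :=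
  exists k : nat, (0 < k)%N /\ G_k_determined k A.

Definition in_tangent (A M : M22) : Prop :=
  exists (c d : 'I_2 -> 'I_2 -> ps) (f : 'I_s -> ps),
    (forall v, in_m (f v)) /\
    M = mx_add (mx_add
          (mx_sum (fun pq : 'I_2 * 'I_2 => mx_rscale (c pq.1 pq.2) (mx_mul (Epq pq.1 pq.2) A)))
          (mx_sum (fun hl : 'I_2 * 'I_2 => mx_rscale (d hl.1 hl.2) (mx_mul A (Epq hl.1 hl.2)))))
          (mx_sum (fun v : 'I_s => mx_rscale (f v) (mx_deriv v A))).

(* dim_K (M_{2,2} / T) < oo : finitely many matrices span M_{2,2} modulo T *)
Definition finite_codim_tangent (A : M22) : Prop :=
  exists (n : nat) (B : 'I_n -> M22),
    forall M : M22, exists a : 'I_n -> K,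
      in_tangent A (mx_sub M (mx_sum (fun i => mx_Kscale (a i) (B i)))).

End PowerSeries.

Definition infinite_type (T : eqType) : Prop := forall l : seq T, exists x, x \notin l.

(* Main.v *)
Require Import Defs.
From HB Require Import structures.
From mathcomp Require Import all_boot all_order all_algebra.
From mathcomp Require Import boolp ring zify.
Set Implicit Arguments. Unset Strict Implicit. Unset Printing Implicit Defensive.
Import GRing.Theory.
Local Open Scope ring_scope.

(** If the tangent image contains a power of each variable times each matrix unit, then
    it contains everything of large order with controlled coefficients, and a Newton-type
    iteration on (1 + X) A(x + f) (1 + Y) = B converges m-adically; this gives (2) => (1).

    For (1) => (2), finite codimension is invariant under G, so it is enough to find, for
    every k, a matrix of finite codimension with the same k-jet as A.  Let A' be the
    polynomial k-jet and B = A' + sum_i x_i^N V_i with N > k invertible in K and constant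
    matrices V_i in general position on a twisted cubic (here K must be infinite).  The
    top-degree forms of the polynomial tangent module of B already have finite codimension:
    writing y_i = x_i^N, they are generated by y_i V_i, E (sum y_i V_i) and (sum y_i V_i) E,
    and one eliminates successively the products of four y's with four, three, two and one
    distinct factors.  Hence the polynomial tangent module has finite codimension, and some
    nonzero polynomial in each x_v kills the quotient; over power series this polynomial is
    a unit times a power of x_v. *)

(** * The power series ring *)

(** For (1) => (2) one cannot compare the tangent image with the tangent space of the orbit: in
    positive characteristic the orbit map may be inseparable and the tangent image too small.
    Determinacy is therefore used only to replace [A] by one explicit matrix with the same jet. The
    perturbation has order above [k], so near the origin it is hidden behind the jet of [A], about
    which nothing is known. It dominates at the other end, among the forms of top degree; this
    forces the passage through polynomials, and a relation between powers of a single variable leads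
    back to the origin. Products of four y's occur because the 2 x 2 matrices over [K] have
    dimension four, so that four distinct [V_i] span them. With fewer distinct indices the missing
    directions must come from the relations [sum y_i E V_i] and [sum y_i V_i E], and each such case
    asks for its own nondegeneracy condition: on triples, on pairs, and on single parameters. *)

Section Monomials.
Variable s : nat.
Implicit Types a b c : mono s.

Lemma maddC a b : madd a b = madd b a.
Proof. by apply/ffunP=> i; rewrite !ffunE addnC. Qed.

Lemma maddA a b c : madd a (madd b c) = madd (madd a b) c.
Proof. by apply/ffunP=> i; rewrite !ffunE addnA. Qed.

Lemma madd0 a : madd (mzero s) a = a.
Proof. by apply/ffunP=> i; rewrite !ffunE. Qed.

Lemma mdegD a b : mdeg (madd a b) = (mdeg a + mdeg b)%N.
Proof. by rewrite /mdeg -big_split; apply: eq_bigr => i _; rewrite ffunE. Qed.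

Lemma mdeg0 : mdeg (mzero s) = 0%N.
Proof. by rewrite /mdeg big1 // => i _; rewrite ffunE. Qed.

Lemma mdeg_eq0 a : (mdeg a == 0%N) = (a == mzero s).
Proof.
apply/eqP/eqP=> [h|->]; last exact: mdeg0.
apply/ffunP=> i; rewrite ffunE; move/eqP: h.
by rewrite /mdeg sum_nat_eq0 => /forallP /(_ i) /= /eqP.
Qed.

Lemma mdeg_munit i : mdeg (munit i : mono s) = 1%N.
Proof.
rewrite /mdeg (bigD1 i) //= big1 ?ffunE ?eqxx // => j.
by rewrite ffunE => /negbTE ->.
Qed.

Lemma leq_mdeg a i : (a i <= mdeg a)%N.
Proof. by rewrite /mdeg (bigD1 i) //= leq_addr. Qed.

Lemma maddIl a b c : (madd a b == madd a c) = (b == c).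
Proof.
apply/eqP/eqP=> [/ffunP h|-> //]; apply/ffunP=> i.
by have := h i; rewrite !ffunE => /addnI.
Qed.

Definition mle a b := [forall i, (a i <= b i)%N].

Lemma mle_addr a b : mle a (madd a b).
Proof. by apply/forallP=> i; rewrite ffunE leq_addr. Qed.

Lemma msubK a b : mle a b -> madd a (msub b a) = b.
Proof. by move/forallP=> h; apply/ffunP=> i; rewrite !ffunE subnKC. Qed.

Lemma madd_eq a b c : (madd a b == c) = mle a c && (b == msub c a).
Proof.
apply/eqP/andP=> [<-|[h /eqP->]]; last exact: msubK.
by rewrite mle_addr -(maddIl a) msubK ?mle_addr.
Qed.

(** A box of exponents instead of a simplex of degrees: it is the image of the index type of
    [ps_mul], and it contains every monomial of degree at most [n]. *)
Definition mons n : seq (mono s) :=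
  [seq ord_to_mono u | u <- enum {: {ffun 'I_s -> 'I_n.+1}}].

Lemma ord_to_mono_inj n : injective (@ord_to_mono s n).
Proof.
move=> b c /ffunP h; apply/ffunP=> i; apply/val_inj.
by have := h i; rewrite !ffunE.
Qed.

Lemma mons_uniq n : uniq (mons n).
Proof. by rewrite map_inj_uniq ?enum_uniq //; exact: ord_to_mono_inj. Qed.

Lemma mem_mons n a : (a \in mons n) = [forall i, (a i <= n)%N].
Proof.
apply/mapP/forallP=> [[b _ -> i]|h].
  by rewrite ffunE -ltnS ltn_ord.
exists [ffun i => Ordinal (h i : (a i < n.+1)%N)]; first by rewrite mem_enum.
by apply/ffunP=> i; rewrite !ffunE.
Qed.

Lemma mdeg_mons n a : (mdeg a <= n)%N -> a \in mons n.
Proof.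
by move=> h; rewrite mem_mons; apply/forallP=> i; apply: leq_trans (leq_mdeg a i) h.
Qed.

Lemma sum_mons_eq (V : nmodType) n (F : mono s -> V) c : c \in mons n ->
  \sum_(b <- mons n | b == c) F b = F c.
Proof.
move=> h; rewrite big_mkcond (bigD1_seq c) ?mons_uniq //= eqxx.
by rewrite big1 ?addr0 // => i /negbTE ->.
Qed.

Lemma big_mons_perm (V : nmodType) n k (P : pred (mono s)) (F : mono s -> V) :
  (forall b, P b -> mdeg b <= n)%N -> (n <= k)%N ->
  \sum_(b <- mons k | P b) F b = \sum_(b <- mons n | P b) F b.
Proof.
move=> h nk; rewrite -big_filter -[RHS]big_filter; apply: perm_big; apply: uniq_perm.
- by rewrite filter_uniq ?mons_uniq.
- by rewrite filter_uniq ?mons_uniq.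
move=> b; rewrite !mem_filter; case Pb: (P b) => //=.
by rewrite !mdeg_mons // ?h // (leq_trans (h _ Pb)).
Qed.

End Monomials.

Section RingStructure.
Variables (K : fieldType) (s : nat).
Implicit Types (f g h : ps K s) (a b c d : mono s).

(** In this symmetric form commutativity and associativity become exchanges of sums; the free bound
    [n] lets nested products share one index list. *)
Lemma ps_mulE n f g a : (mdeg a <= n)%N ->
  ps_mul f g a =
    \sum_(b <- mons s n) \sum_(c <- mons s n | madd b c == a) f b * g c.
Proof.
move=> an.
transitivity (\sum_(b <- mons s (mdeg a) | mle b a) f b * g (msub a b)).
  rewrite /ps_mul /mons big_map big_enum_cond /=; apply: eq_bigl => b /=.
  by apply: eq_forallb => i; rewrite ffunE.
rewrite -(@big_mons_perm s _ _ n) //; last first.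
  by move=> b /msubK <-; rewrite mdegD leq_addr.
rewrite big_mkcond; apply: eq_bigr => b _; case: ifP => ba; last first.
  by rewrite big1 // => c; rewrite madd_eq ba.
under eq_bigl => c do rewrite madd_eq ba /=.
rewrite sum_mons_eq //; apply: mdeg_mons; apply: leq_trans an.
by rewrite -{2}(msubK ba) mdegD leq_addl.
Qed.

Lemma ps_mulC f g : ps_mul f g = ps_mul g f.
Proof.
apply/funext=> a; rewrite !(ps_mulE _ _ (leqnn _)).
rewrite (exchange_big_dep xpredT) //=; apply: eq_bigr => b _.
by apply: eq_big => [c|c _]; rewrite 1?maddC // mulrC.
Qed.

Lemma ps_mul3E n f g h a : (mdeg a <= n)%N ->
  ps_mul f (ps_mul g h) a =
    \sum_(b <- mons s n) \sum_(c <- mons s n) \sum_(d <- mons s n |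
      madd b (madd c d) == a) f b * (g c * h d).
Proof.
move=> an; rewrite (ps_mulE _ _ an); apply: eq_bigr => b _.
transitivity (\sum_(e <- mons s n | madd b e == a) \sum_(c <- mons s n)
   \sum_(d <- mons s n | madd c d == e) f b * (g c * h d)).
  apply: eq_bigr => e /eqP ea; rewrite (@ps_mulE n); last first.
    by apply: leq_trans an; rewrite -ea mdegD leq_addl.
  by rewrite mulr_sumr; apply: eq_bigr => c _; rewrite mulr_sumr.
rewrite (exchange_big_dep xpredT) //=; apply: eq_bigr => c _.
rewrite (exchange_big_dep xpredT) //= [RHS]big_mkcond; apply: eq_bigr => d _.
case: ifP => [/eqP E|E].
  rewrite -[RHS](@sum_mons_eq s _ n (fun=> f b * (g c * h d)) (madd c d)).
    by apply: eq_bigl => e; rewrite (eq_sym e);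
      case: (eqVneq (madd c d) e) => [<-|_]; rewrite ?E ?eqxx ?andbF.
  by apply: mdeg_mons; apply: leq_trans an; rewrite -E [X in (_ <= X)%N]mdegD leq_addl.
by rewrite big1 // => e; rewrite andbT => /andP[/eqP D1 /eqP D2]; rewrite D2 D1 eqxx in E.
Qed.

Lemma ps_mulA f g h : ps_mul f (ps_mul g h) = ps_mul (ps_mul f g) h.
Proof.
apply/funext=> a; rewrite [in RHS]ps_mulC !(ps_mul3E _ _ _ (leqnn _)).
rewrite [RHS]exchange_big; apply: eq_bigr => b _ /=.
rewrite [RHS](exchange_big_dep xpredT) //=; apply: eq_bigr => c _.
by apply: eq_big => [d|d _]; [rewrite maddA maddC | ring].
Qed.

Lemma ps_mul1 f : ps_mul (@ps1 K s) f = f.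
Proof.
apply/funext=> a; rewrite (ps_mulE _ _ (leqnn _)).
rewrite (bigD1_seq (mzero s)) ?mons_uniq ?mdeg_mons ?mdeg0 //=.
rewrite [X in _ + X]big1 => [|b nb]; last first.
  by rewrite big1 // => c _; rewrite /ps1 /ps_coefK (negbTE nb) mul0r.
under eq_bigl => c do rewrite madd0.
by rewrite addr0 sum_mons_eq ?mdeg_mons // /ps1 /ps_coefK eqxx mul1r.
Qed.

Lemma ps_mulDl : left_distributive (@ps_mul K s) (@ps_add K s).
Proof.
move=> f g h; apply/funext=> a; rewrite /ps_add !(ps_mulE _ _ (leqnn _)).
rewrite -big_split; apply: eq_bigr => b _ /=; rewrite -big_split.
by apply: eq_bigr => c _ /=; rewrite mulrDl.
Qed.

Lemma ps_addA : associative (@ps_add K s).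
Proof. by move=> f g h; apply/funext=> a; rewrite /ps_add addrA. Qed.
Lemma ps_addC : commutative (@ps_add K s).
Proof. by move=> f g; apply/funext=> a; rewrite /ps_add addrC. Qed.
Lemma ps_add0 : left_id (@ps0 K s) (@ps_add K s).
Proof. by move=> f; apply/funext=> a; rewrite /ps_add /ps0 /ps_coefK if_same add0r. Qed.
Lemma ps_addN : left_inverse (@ps0 K s) (@ps_opp K s) (@ps_add K s).
Proof.
by move=> f; apply/funext=> a; rewrite /ps_add /ps_opp /ps0 /ps_coefK if_same addNr.
Qed.

HB.instance Definition _ := gen_eqMixin (ps K s).
HB.instance Definition _ := gen_choiceMixin (ps K s).
HB.instance Definition _ :=
  GRing.isZmodule.Build (ps K s) ps_addA ps_addC ps_add0 ps_addN.

Lemma ps1_neq0 : @ps1 K s != 0.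
Proof.
apply/eqP=> /(congr1 (fun f : ps K s => f (mzero s))).
by rewrite /ps1 /ps_coefK eqxx => /eqP; rewrite [X in _ == X]if_same oner_eq0.
Qed.

HB.instance Definition _ := GRing.Zmodule_isComNzRing.Build (ps K s)
  ps_mulA ps_mulC ps_mul1 ps_mulDl ps1_neq0.

End RingStructure.

Section Coefficients.
Variables (K : fieldType) (s : nat).
Implicit Types (f g h : ps K s) (a b d : mono s).

Lemma coefD f g a : (f + g) a = f a + g a.
Proof. by []. Qed.

Lemma coefN f a : (- f) a = - f a.
Proof. by []. Qed.

Lemma coefB f g a : (f - g) a = f a - g a.
Proof. by []. Qed.

Lemma coef0 a : (0 : ps K s) a = 0.
Proof. exact: if_same. Qed.

Lemma coef1 a : (1 : ps K s) a = (a == mzero s)%:R.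
Proof. by rewrite -[1]/(@ps1 K s) /ps1 /ps_coefK; case: eqP. Qed.

Lemma coef_sum (I : Type) (r : seq I) (P : pred I) (F : I -> ps K s) a :
  (\sum_(i <- r | P i) F i) a = \sum_(i <- r | P i) F i a.
Proof. by apply: (big_morph (fun f : ps K s => f a)) => //; exact: coef0. Qed.

Lemma coefM n f g a : (mdeg a <= n)%N ->
  (f * g) a = \sum_(b <- mons s n) \sum_(c <- mons s n | madd b c == a) f b * g c.
Proof. exact: ps_mulE. Qed.

Definition mon b : ps K s := fun a => (a == b)%:R.

Lemma coef_monM b f a : (mon b * f) a = if mle b a then f (msub a b) else 0.
Proof.
rewrite (coefM _ _ (leqnn _)); have E c : madd b c == a -> mle b a.
  by rewrite madd_eq => /andP[].
case: ifP => ba; last first.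
  rewrite big1_seq // => c _; rewrite big1_seq // => d /andP[cd _].
  rewrite /mon; case: (eqVneq c b) cd => [-> /E|_ _]; first by rewrite ba.
  by rewrite mul0r.
have da : (mdeg (msub a b) <= mdeg a)%N by rewrite -{2}(msubK ba) mdegD leq_addl.
have db : (mdeg b <= mdeg a)%N by rewrite -(msubK ba) mdegD leq_addr.
rewrite (bigD1_seq b) ?mons_uniq ?mdeg_mons //= [X in _ + X]big1 => [|c /negbTE nb].
  under eq_bigl => c do rewrite madd_eq ba /=.
  by rewrite sum_mons_eq ?mdeg_mons // addr0 /mon eqxx mul1r.
by rewrite big1 // => d _; rewrite /mon nb mul0r.
Qed.

Lemma coef_monMD b f a : (mon b * f) (madd b a) = f a.
Proof.
rewrite coef_monM mle_addr; congr (f _); apply/eqP.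
by rewrite -(maddIl b) msubK ?mle_addr.
Qed.

Lemma monM_inj b : injective (fun f => mon b * f).
Proof.
move=> f g E; apply/funext=> a.
by rewrite -(coef_monMD b) [mon b * f]E coef_monMD.
Qed.

Lemma monD a b : mon (madd a b) = mon a * mon b.
Proof.
apply/funext=> c; rewrite coef_monM /mon eq_sym madd_eq.
by case: ifP => //= _; rewrite eq_sym.
Qed.

Lemma mon0 : mon (mzero s) = 1.
Proof. by apply/funext=> a; rewrite coef1. Qed.

Definition mpure (v : 'I_s) n : mono s := [ffun u => if u == v then n else 0%N].

Lemma mdeg_mpure v n : mdeg (mpure v n) = n.
Proof.
rewrite /mdeg (bigD1 v) //= ffunE eqxx big1 ?addn0 // => u /negbTE nu.
by rewrite ffunE nu.
Qed.

Lemma mle_mpure v n a : mle (mpure v n) a = (n <= a v)%N.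
Proof.
apply/forallP/idP=> [/(_ v)|h u]; first by rewrite ffunE eqxx.
by rewrite ffunE; case: eqP => // ->.
Qed.

Definition var v : ps K s := @ps_var K s v.

Lemma varE v : var v = mon (munit v).
Proof. by apply/funext=> a; rewrite /var /ps_var /mon; case: eqP. Qed.

Lemma munitE v : munit v = mpure v 1 :> mono s.
Proof. by apply/ffunP=> u; rewrite !ffunE; case: eqP. Qed.

Lemma varX v n : var v ^+ n = mon (mpure v n).
Proof.
elim: n => [|n IH].
  by rewrite expr0 -mon0; congr mon; apply/ffunP=> u; rewrite !ffunE if_same.
rewrite exprS IH varE munitE -monD; congr mon; apply/ffunP=> u.
by rewrite !ffunE; case: eqP.
Qed.

Lemma varM_inj v : injective (fun f => var v * f).
Proof. by rewrite varE; exact: monM_inj. Qed.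

Definition cst (c : K) : ps K s := @ps_coefK K s c.

Lemma cstM c f a : (cst c * f) a = c * f a.
Proof.
have -> : cst c = (fun a => c * (mon (mzero s)) a) :> ps K s.
  apply/funext=> b; rewrite /cst /ps_coefK /mon.
  by case: eqP; rewrite ?mulr1 ?mulr0.
rewrite -[f in RHS]mul1r -mon0 !(coefM _ _ (leqnn _)) mulr_sumr.
apply: eq_bigr => b _; rewrite mulr_sumr; apply: eq_bigr => d _.
by rewrite mulrA.
Qed.

Lemma coef_cst c a : cst c a = if a == mzero s then c else 0.
Proof. by []. Qed.

Lemma cst_is_zmod_morphism : zmod_morphism cst.
Proof.
by move=> c e; apply/funext=> a; rewrite coefB !coef_cst; case: eqP; rewrite ?subr0.
Qed.

Lemma cst_is_monoid_morphism : monoid_morphism cst.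
Proof.
by split=> // c e; apply/funext=> a; rewrite cstM !coef_cst; case: eqP; rewrite ?mulr0.
Qed.

HB.instance Definition _ := GRing.isZmodMorphism.Build K (ps K s) cst
  cst_is_zmod_morphism.
HB.instance Definition _ := GRing.isMonoidMorphism.Build K (ps K s) cst
  cst_is_monoid_morphism.

Lemma ps_scaleE c f : ps_scale c f = cst c * f.
Proof. by apply/funext=> a; rewrite cstM. Qed.

End Coefficients.

Arguments cst {K} s c.

(** * Order, degree and m-adic completeness *)

Section Order.
Variables (K : fieldType) (s : nat).
Implicit Types (f g h : ps K s) (a b d : mono s).

Definition ordge n f := forall a, (mdeg a < n)%N -> f a = 0.

Definition deglt n f := forall a, (n <= mdeg a)%N -> f a = 0.

Lemma ordge0n f : ordge 0 f. Proof. by []. Qed.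

Lemma ordge_0 n : ordge n 0. Proof. by move=> a _; rewrite coef0. Qed.

Lemma ordgeD n f g : ordge n f -> ordge n g -> ordge n (f + g).
Proof. by move=> hf hg a h; rewrite coefD hf ?hg ?addr0. Qed.

Lemma ordgeN n f : ordge n f -> ordge n (- f).
Proof. by move=> hf a h; rewrite coefN hf ?oppr0. Qed.

Lemma ordgeB n f g : ordge n f -> ordge n g -> ordge n (f - g).
Proof. by move=> hf hg; apply: ordgeD => //; apply: ordgeN. Qed.

Lemma ordge_sum (I : Type) (r : seq I) (P : pred I) (F : I -> ps K s) n :
  (forall i, P i -> ordge n (F i)) -> ordge n (\sum_(i <- r | P i) F i).
Proof. by move=> h a an; rewrite coef_sum big1 // => i /h ->. Qed.

Lemma ordgeM n m f g : ordge n f -> ordge m g -> ordge (n + m) (f * g).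
Proof.
move=> hf hg a an; rewrite (coefM _ _ (leqnn _)).
rewrite big1_seq // => b _; rewrite big1_seq // => c /andP[/eqP E _].
case: (ltnP (mdeg b) n) => hb; first by rewrite hf ?mul0r.
rewrite hg ?mulr0 //; move: an; rewrite -E mdegD => an.
by rewrite -(ltn_add2l n) (leq_ltn_trans _ an) // leq_add2r.
Qed.

Lemma ordge_le m n f : (m <= n)%N -> ordge n f -> ordge m f.
Proof. by move=> mn h a am; apply: h; apply: leq_trans am mn. Qed.

Lemma ordgeMl n f g : ordge n g -> ordge n (f * g).
Proof. by move=> h; apply: (ordgeM (ordge0n f) h). Qed.

Lemma ordgeMr n f g : ordge n f -> ordge n (f * g).
Proof. by move=> h; rewrite mulrC; exact: ordgeMl. Qed.

Lemma ordge_eq0 f : (forall n, ordge n f) -> f = 0.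
Proof. by move=> h; apply/funext=> a; rewrite coef0 (h (mdeg a).+1). Qed.

Lemma in_mE f : in_m f <-> ordge 1 f.
Proof.
split=> [h a|h]; last by apply: h; rewrite mdeg0.
by rewrite ltnS leqn0 mdeg_eq0 => /eqP ->.
Qed.

Lemma ordge_mon b : ordge (mdeg b) (mon K b).
Proof. by move=> a; rewrite /mon; case: eqP => // ->; rewrite ltnn. Qed.

Lemma ordge_var v : ordge 1 (var K v : ps K s).
Proof. by rewrite varE -{1}(mdeg_munit v); exact: ordge_mon. Qed.

Lemma ordgeX n f : ordge 1 f -> ordge n (f ^+ n).
Proof.
move=> h; elim: n => [|n IH]; first exact: ordge0n.
by rewrite exprS -add1n; apply: ordgeM.
Qed.

Lemma deglt_0 n : deglt n 0. Proof. by move=> a _; rewrite coef0. Qed.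

Lemma degltD n f g : deglt n f -> deglt n g -> deglt n (f + g).
Proof. by move=> hf hg a h; rewrite coefD hf ?hg ?addr0. Qed.

Lemma degltN n f : deglt n f -> deglt n (- f).
Proof. by move=> hf a h; rewrite coefN hf ?oppr0. Qed.

Lemma deglt_sum (I : Type) (r : seq I) (P : pred I) (F : I -> ps K s) n :
  (forall i, P i -> deglt n (F i)) -> deglt n (\sum_(i <- r | P i) F i).
Proof. by move=> h a an; rewrite coef_sum big1 // => i /h ->. Qed.

Lemma deglt_le m n f : (m <= n)%N -> deglt m f -> deglt n f.
Proof. by move=> mn h a am; apply: h; apply: leq_trans mn am. Qed.

(** The first factor has degree at most [n], the second degree less than [m]; this asymmetry avoids
    a truncated subtraction. *)
Lemma degltM n m f g : deglt n.+1 f -> deglt m g -> deglt (n + m) (f * g).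
Proof.
move=> hf hg a an; rewrite (coefM _ _ (leqnn _)).
rewrite big1_seq // => b _; rewrite big1_seq // => c /andP[/eqP E _].
case: (ltnP n (mdeg b)) => hb; first by rewrite hf ?mul0r.
rewrite hg ?mulr0 //; move: an; rewrite -E mdegD => an.
by rewrite -(leq_add2l n) (leq_trans an) // leq_add2r.
Qed.

Lemma deglt_mon b : deglt (mdeg b).+1 (mon K b).
Proof. by move=> a; rewrite /mon; case: eqP => // ->; rewrite ltnn. Qed.

Lemma deglt_cst c : deglt 1 (cst s c).
Proof.
by move=> a; rewrite coef_cst; case: eqP => // ->; rewrite mdeg0.
Qed.

Lemma deglt_varX v n : deglt n.+1 (var K v ^+ n : ps K s).
Proof. by rewrite varX -{1}(mdeg_mpure v n); exact: deglt_mon. Qed.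

(* Each monomial of [f] is charged to the first variable occurring with exponent
   at least [D]. *)
Lemma split_vars D f : (forall a, f a != 0 -> exists v, (D <= a v)%N) ->
  exists g : 'I_s -> ps K s, [/\ f = \sum_v var K v ^+ D * g v,
    forall n, ordge n f -> forall v, ordge (n - D) (g v) &
    forall n, deglt n f -> forall v, deglt (n - D) (g v)].
Proof.
move=> hf; pose g v : ps K s := fun b => let a := madd (mpure v D) b in
  if [pick u | (D <= a u)%N] == Some v then f a else 0.
exists g; split.
- apply/funext=> a; rewrite coef_sum.
  under eq_bigr => v _ do rewrite varX coef_monM mle_mpure.
  have E v : (if (D <= a v)%N then g v (msub a (mpure v D)) else 0) =
             if [pick u | (D <= a u)%N] == Some v then f a else 0.
    case: ifP => h; first by rewrite /g msubK ?mle_mpure.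
    by case: pickP => // u hu; case: eqP => // -[eu]; rewrite -eu hu in h.
  under eq_bigr => v _ do rewrite E.
  case: pickP => [u hu|nu].
    rewrite (bigD1 u) //= eqxx big1 ?addr0 // => v /negbTE nv.
    by case: eqP => // -[uv]; rewrite uv eqxx in nv.
  rewrite big1 //; case: (eqVneq (f a) 0) => // /hf [v hv].
  by rewrite nu in hv.
- move=> n h v a an; rewrite /g; case: ifP => // _; apply: h.
  by rewrite mdegD mdeg_mpure; lia.
move=> n h v a an; rewrite /g; case: ifP => // _; apply: h.
by rewrite mdegD mdeg_mpure; lia.
Qed.

Lemma exists_large_exponent D a : (s * D < mdeg a)%N -> exists v, (D <= a v)%N.
Proof.
move=> h; apply/existsP; apply: contraLR h; rewrite negb_exists -leqNgt => /forallP h.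
rewrite /mdeg -[X in (_ <= X * _)%N]card_ord -sum_nat_const; apply: leq_sum => v _.
by have := h v; rewrite -ltnNge => /ltnW.
Qed.

(** The decomposition behind the inductions on the order below: algebra morphisms and derivations
    are not assumed continuous, so they cannot be evaluated on a series term by term, but they can
    on this finite sum. *)
Lemma split_const f : exists g : 'I_s -> ps K s,
  f = cst s (f (mzero s)) + \sum_v var K v * g v.
Proof.
have [a|g [E _ _]] := @split_vars 1 (f - cst s (f (mzero s))).
  rewrite coefB coef_cst.
  case: (eqVneq a (mzero s)) => [->|n0 _]; first by rewrite subrr eqxx.
  move: n0; rewrite -mdeg_eq0 /mdeg sum_nat_eq0 negb_forall => /existsP[v].
  by rewrite /= -lt0n; exists v.
exists g; rewrite -[LHS](subrK (cst s (f (mzero s)))) addrC E.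
by congr (_ + _); apply: eq_bigr => v _; rewrite expr1.
Qed.

Lemma split_ordgeS n f : ordge n.+1 f -> exists g : 'I_s -> ps K s,
  f = \sum_v var K v * g v /\ forall v, ordge n (g v).
Proof.
move=> h; have [a|g [E hg _]] := @split_vars 1 f.
  case: (eqVneq a (mzero s)) => [->|n0 _].
    by rewrite h ?eqxx ?mdeg0.
  move: n0; rewrite -mdeg_eq0 /mdeg sum_nat_eq0 negb_forall => /existsP[v].
  by rewrite /= -lt0n; exists v.
exists g; split; last by move=> v; have := hg _ h v; rewrite subn1.
by rewrite E; apply: eq_bigr => v _; rewrite expr1.
Qed.

Lemma in_mpowE n f : in_mpow n f <-> ordge n f.
Proof.
elim: n f => [|n IH] f //=; split.
  case=> l [hl ->]; elim: l hl => [|p l IHl] hl; first exact: ordge_0.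
  apply: ordgeD.
    have [h1 h2] := hl p (or_introl erefl).
    by rewrite -add1n; apply: ordgeM; [apply/in_mE | apply/IH].
  by apply: IHl => q hq; apply: hl; right.
case/split_ordgeS=> g [-> hg].
exists [seq (var K v, g v) | v <- index_enum 'I_s]; split.
  move=> p; elim: (index_enum _) => //= v l IHl [<-|] //.
  by split; [apply/in_mE; exact: ordge_var | apply/IH; exact: hg].
rewrite -[in LHS](map_id (index_enum _)) big_map.
by elim: (index_enum _) => [|v l IHl] /=; rewrite ?big_nil ?big_cons ?IHl.
Qed.

Lemma ps_lim (u : nat -> ps K s) : (forall n, ordge n (u n.+1 - u n)) ->
  exists l, forall n, ordge n (l - u n).
Proof.
(* [u n.+1 - u n] has order [n] only, so a coefficient of degree [d] is stable from index [d + 1]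
   on. *)
move=> hu; exists (fun a => u (mdeg a).+1 a) => n a an.
have E k : u ((mdeg a).+1 + k)%N a = u (mdeg a).+1 a.
  elim: k => [|k IH]; first by rewrite addn0.
  apply/eqP; rewrite addnS -IH -subr_eq0 -coefB hu //.
  by rewrite addSn ltnS leq_addr.
by rewrite coefB -(subnKC an) E subrr.
Qed.

Lemma ps_unit f : f (mzero s) != 0 -> exists g, f * g = 1.
Proof.
move=> f0; pose h := 1 - cst s (f (mzero s))^-1 * f.
have hm : ordge 1 h.
  by apply/in_mE; rewrite /in_m /h coefB cstM coef1 eqxx mulVf ?subrr.
pose u n := \sum_(i < n) h ^+ i.
have [n|l hl] := @ps_lim u.
  by rewrite /u big_ord_recr /= addrAC subrr add0r; exact: ordgeX.
exists (l * cst s (f (mzero s))^-1); apply/eqP; rewrite -subr_eq0; apply/eqP.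
apply: ordge_eq0 => n; set c := cst _ _.
have E : 1 - h ^+ n = (1 - h) * u n by rewrite -opprB subrX1 -mulNr opprB.
have -> : f * (l * c) - 1 = (1 - h) * (l - u n) - h ^+ n.
  have -> : (1 - h) * (l - u n) - h ^+ n = (1 - h) * l - ((1 - h) * u n + h ^+ n) by ring.
  by rewrite -E /h -/c; ring.
by apply: ordgeB; [apply: ordgeMl | apply: ordgeX].
Qed.

End Order.

(** * Partial derivatives *)

Section Derivative.
Variables (K : fieldType) (s : nat).
Implicit Types (f g h : ps K s) (v u : 'I_s).

Local Notation deriv := (@ps_deriv K s).

Lemma derivD v f g : deriv v (f + g) = deriv v f + deriv v g.
Proof. by apply/funext=> a; rewrite /ps_deriv !coefD mulrDr. Qed.

(** The operator [x_v d/dx_v] acts diagonally on coefficients, so its Leibniz rule is immediate;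
    cancelling [x_v] gives the rule for the derivative. *)
Definition euler v f : ps K s := fun a => (a v)%:R * f a.

Lemma eulerE v f : euler v f = var K v * deriv v f.
Proof.
apply/funext=> a; rewrite varE coef_monM munitE mle_mpure /euler /ps_deriv.
case: ifP => h; last by move: h; rewrite lt0n => /negbFE/eqP ->; rewrite mul0r.
rewrite munitE maddC msubK ?mle_mpure // !ffunE eqxx subn1 prednK //.
Qed.

Lemma euler_mul v f g : euler v (f * g) = euler v f * g + f * euler v g.
Proof.
apply/funext=> a; rewrite coefD {1}/euler !(coefM _ _ (leqnn _)) mulr_sumr -big_split.
apply: eq_bigr => b _ /=; rewrite mulr_sumr -big_split; apply: eq_bigr => c /eqP <- /=.
by rewrite /euler ffunE natrD; ring.
Qed.

Lemma derivM v f g : deriv v (f * g) = deriv v f * g + f * deriv v g.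
Proof.
apply: (@varM_inj K s v) => /=; rewrite -eulerE euler_mul !eulerE; ring.
Qed.

Lemma deriv_cst v c : deriv v (cst s c) = 0.
Proof.
apply/funext=> a; rewrite /ps_deriv coef0 coef_cst -mdeg_eq0 mdegD mdeg_munit addn1.
by rewrite mulr0.
Qed.

Lemma deriv_var v u : deriv v (var K u) = (u == v)%:R.
Proof.
apply: (@varM_inj K s v) => /=; rewrite -eulerE; apply/funext=> a.
rewrite /euler varE /mon; case: (eqVneq u v) => [->|uv].
  by rewrite mulr1 varE /mon; case: eqP => [->|]; rewrite ?mulr0 // mulr1 ffunE eqxx.
rewrite mulr0 coef0; case: eqP => [->|]; rewrite ?mulr0 //.
by rewrite ffunE eq_sym (negbTE uv) mul0r.
Qed.

Lemma derivX v f n : deriv v (f ^+ n) = deriv v f * f ^+ n.-1 *+ n.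
Proof.
elim: n => [|n IH]; first by rewrite expr0 mulr0n -(rmorph1 (@cst K s)) deriv_cst.
rewrite exprS derivM IH /= [in RHS]mulrS; congr (_ + _).
case: n IH => [|n] _; first by rewrite !mulr0n mulr0.
by rewrite /= exprS mulrnAr; congr (_ *+ _); ring.
Qed.

Lemma deglt_deriv v n f : deglt n f -> deglt n.-1 (deriv v f).
Proof.
move=> h a an; rewrite /ps_deriv h ?mulr0 // mdegD mdeg_munit.
by lia.
Qed.

Lemma deriv_sum v (I : Type) (r : seq I) (P : pred I) (F : I -> ps K s) :
  deriv v (\sum_(i <- r | P i) F i) = \sum_(i <- r | P i) deriv v (F i).
Proof.
apply: (big_morph (deriv v) (derivD v)).
by rewrite -(rmorph0 (@cst K s)) deriv_cst rmorph0.
Qed.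

(* A derivation vanishing on constants and variables vanishes, because it lowers the
   order by at most one. *)
Lemma derivation_eq (D E : ps K s -> ps K s) :
  {morph D : f g / f + g} -> {morph E : f g / f + g} ->
  (forall f g, D (f * g) = D f * g + f * D g) ->
  (forall f g, E (f * g) = E f * g + f * E g) ->
  (forall c, D (cst s c) = E (cst s c)) -> (forall v, D (var K v) = E (var K v)) ->
  D =1 E.
Proof.
move=> DD ED DM EM Dc Dv f; apply/eqP; rewrite -subr_eq0; apply/eqP.
apply: ordge_eq0 => n; elim: n f => [|n IH] f; first exact: ordge0n.
have [g ->] := split_const f.
have S (T : ps K s -> ps K s) : {morph T : f g / f + g} ->
    T (\sum_v var K v * g v) = \sum_v T (var K v * g v).
  move=> TD; apply: (big_morph T TD); apply: (addrI (T 0)).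
  by rewrite -TD !addr0.
rewrite DD ED Dc opprD addrACA subrr add0r !S // -sumrB; apply: ordge_sum => v _.
rewrite DM EM Dv opprD addrACA subrr add0r -mulrBr -add1n.
by apply: ordgeM; [exact: ordge_var | exact: IH].
Qed.

End Derivative.

(** * Substitutions and algebra automorphisms *)

Section Substitution.
Variables (K : fieldType) (s : nat) (g : 'I_s -> ps K s).
Hypothesis g_in_m : forall v, ordge 1 (g v).
Implicit Types (f h : ps K s) (a b : mono s).

Definition mpow b : ps K s := \prod_v g v ^+ b v.

Lemma mpowD a b : mpow (madd a b) = mpow a * mpow b.
Proof. by rewrite -big_split; apply: eq_bigr => v _; rewrite ffunE exprD. Qed.

Lemma ordge_mpow b : ordge (mdeg b) (mpow b).
Proof.
rewrite /mpow /mdeg; elim/big_rec2: _ => [|v x y _ h]; first exact: ordge0n.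
by apply: ordgeM => //; apply: ordgeX.
Qed.

(** Truncating the sum at [mdeg a] loses nothing when the [g v] lie in [m], because [mpow b] then
    has order at least [mdeg b]. *)
Definition subst f : ps K s := fun a => \sum_(b <- mons s (mdeg a)) f b * mpow b a.

Lemma substE n f a : (mdeg a <= n)%N ->
  subst f a = \sum_(b <- mons s n) f b * mpow b a.
Proof.
move=> an.
have E k : \sum_(b <- mons s k) f b * mpow b a =
           \sum_(b <- mons s k | (mdeg b <= mdeg a)%N) f b * mpow b a.
  rewrite [RHS]big_mkcond; apply: eq_bigr => b _; case: leqP => // ab.
  by rewrite ordge_mpow ?mulr0.
by rewrite /subst E E -(@big_mons_perm s _ _ n).
Qed.

Lemma substD f h : subst (f + h) = subst f + subst h.
Proof.
apply/funext=> a; rewrite coefD /subst -big_split; apply: eq_bigr => b _ /=.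
by rewrite coefD mulrDl.
Qed.

Lemma substM f h : subst (f * h) = subst f * subst h.
Proof.
apply/funext=> a; set n := mdeg a.
transitivity (\sum_(b <- mons s n) \sum_(c <- mons s n) f b * h c * mpow (madd b c) a).
  transitivity (\sum_(e <- mons s n) \sum_(b <- mons s n)
      \sum_(c <- mons s n | madd b c == e) f b * h c * mpow (madd b c) a).
    rewrite (substE _ (leqnn _)); apply: eq_bigr => e _.
    case: (leqP (mdeg e) n) => en.
      rewrite (coefM _ _ en) mulr_suml; apply: eq_bigr => b _; rewrite mulr_suml.
      by apply: eq_bigr => c /eqP ->.
    rewrite ordge_mpow // mulr0 big1 // => b _; rewrite big1 // => c /eqP ->.
    by rewrite ordge_mpow ?mulr0.
  rewrite exchange_big /=; apply: eq_bigr => b _.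
  rewrite (exchange_big_dep xpredT) //=; apply: eq_bigr => c _.
  case: (leqP (mdeg (madd b c)) n) => bc.
    under eq_bigl => e do rewrite eq_sym.
    by rewrite (sum_mons_eq (fun=> _)) ?mdeg_mons.
  by rewrite ordge_mpow // mulr0 big1.
(* Up to degree [n] the substituted series agrees with the finite sum [S], whose products expand by
   bilinearity. *)
pose S k : ps K s := \sum_(b <- mons s n) cst s (k b) * mpow b.
have SE k b : (mdeg b <= n)%N -> subst k b = S k b.
  move=> bn; rewrite (substE _ bn) /S coef_sum; apply: eq_bigr => c _.
  by rewrite cstM.
transitivity ((S f * S h) a); last first.
  rewrite !(coefM _ _ (leqnn _)); apply: eq_bigr => b _; apply: eq_bigr => c /eqP E.
  have := mdegD b c; rewrite E => {}E.
  by rewrite !SE // /n E ?leq_addr ?leq_addl.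
rewrite /S mulr_suml coef_sum; apply: eq_bigr => b _.
rewrite mulr_sumr coef_sum; apply: eq_bigr => c _.
rewrite mpowD; set p := mpow b; set q := mpow c.
have -> : cst s (f b) * p * (cst s (h c) * q) = cst s (f b) * (cst s (h c) * (p * q)).
  by ring.
by rewrite !cstM mulrA.
Qed.

Lemma subst_mon b : subst (mon K b) = mpow b.
Proof.
apply/funext=> a; rewrite (substE _ (leq_addr (mdeg b) (mdeg a))).
rewrite (bigD1_seq b) ?mons_uniq ?mdeg_mons ?leq_addl //= /mon eqxx mul1r.
by rewrite big1 ?addr0 // => c /negbTE ->; rewrite mul0r.
Qed.

Lemma subst_var v : subst (var K v) = g v.
Proof.
rewrite varE subst_mon /mpow (bigD1 v) //= ffunE eqxx expr1 big1 ?mulr1 // => u.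
by move=> /negbTE nu; rewrite ffunE nu expr0.
Qed.

Lemma subst_cst c : subst (cst s c) = cst s c.
Proof.
have E f : subst (cst s c * f) = cst s c * subst f.
  apply/funext=> a; rewrite cstM /subst mulr_sumr; apply: eq_bigr => b _.
  by rewrite cstM mulrA.
rewrite -[cst s c in LHS]mulr1 E -mon0 subst_mon /mpow.
by rewrite big1 ?mulr1 // => v _; rewrite ffunE expr0.
Qed.

End Substitution.

Section AlgebraMorphisms.
Variables (K : fieldType) (s : nat).
Implicit Types (f g h : ps K s).

Definition alg_hom (phi : ps K s -> ps K s) :=
  [/\ {morph phi : f g / f + g}, {morph phi : f g / f * g} &
      forall c, phi (cst s c) = cst s c].

Lemma alg_hom_id : alg_hom id.
Proof. by split. Qed.

Lemma alg_hom_subst (g : 'I_s -> ps K s) : (forall v, ordge 1 (g v)) -> alg_hom (subst g).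
Proof.
by move=> h; split; [exact: substD|exact: substM|exact: subst_cst].
Qed.

Section Hom.
Variable phi : ps K s -> ps K s.
Hypothesis hphi : alg_hom phi.

Lemma alg_hom0 : phi 0 = 0.
Proof. by case: hphi => _ _ hc; rewrite -(rmorph0 (@cst K s)) hc. Qed.

Lemma alg_homN f : phi (- f) = - phi f.
Proof.
case: hphi => hD _ _; apply: (addrI (phi f)).
by rewrite -hD !subrr alg_hom0.
Qed.

Lemma alg_homB f g : phi (f - g) = phi f - phi g.
Proof. by case: hphi => hD _ _; rewrite hD alg_homN. Qed.

Lemma alg_hom_sum (I : Type) (r : seq I) (P : pred I) (F : I -> ps K s) :
  phi (\sum_(i <- r | P i) F i) = \sum_(i <- r | P i) phi (F i).
Proof. by case: hphi => hD _ _; exact: (big_morph phi hD alg_hom0). Qed.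

Lemma alg_hom_split f (g : 'I_s -> ps K s) :
  f = cst s (f (mzero s)) + \sum_v var K v * g v ->
  phi f = cst s (f (mzero s)) + \sum_v phi (var K v) * phi (g v).
Proof.
case: hphi => hD hM hc {1}->; rewrite hD hc alg_hom_sum; congr (_ + _).
by apply: eq_bigr => v _; rewrite hM.
Qed.

End Hom.

(** Each round of the induction on [k] splits off one variable, whose image under [phi] has order at
    least one; this gains one order until the bound [n] on the variables is reached. *)
Lemma alg_hom_close n phi psi : alg_hom phi -> alg_hom psi ->
  (forall v, ordge 1 (phi (var K v))) ->
  (forall v, ordge n (psi (var K v) - phi (var K v))) ->
  forall f, ordge n (psi f - phi f).
Proof.
move=> h1 h2 hm hd f; suff H k : ordge (minn n k) (psi f - phi f).
  by rewrite -[n]minnn.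
elim: k f => [|k IH] f; first by rewrite minn0; exact: ordge0n.
have [g E] := split_const f.
rewrite (alg_hom_split h1 E) (alg_hom_split h2 E) opprD addrACA subrr add0r -sumrB.
apply: ordge_sum => v _.
have -> : psi (var K v) * psi (g v) - phi (var K v) * phi (g v) =
  (psi (var K v) - phi (var K v)) * psi (g v) + phi (var K v) * (psi (g v) - phi (g v)).
  by ring.
apply: ordgeD; first by apply: ordgeMr; apply: ordge_le (hd v); lia.
by apply: (@ordge_le _ _ _ (1 + minn n k)); [lia | apply: ordgeM].
Qed.

(** A first-order expansion about [phi] with the derivatives of [f] left untransformed. Quadratic
    terms have order [2p >= p + q], and ignoring [phi] in the derivatives costs order [p + q], as
    [phi] is the identity modulo [m^q]. The sum [L] is a derivation, so the induction needs no
    higher derivatives and no factorials. *)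
Lemma alg_hom_taylor p q phi psi : alg_hom phi -> alg_hom psi -> (0 < q <= p)%N ->
  (forall v, ordge q (phi (var K v) - var K v)) ->
  (forall v, ordge p (psi (var K v) - phi (var K v))) ->
  forall f, ordge (p + q) (psi f - phi f -
    \sum_v (psi (var K v) - phi (var K v)) * ps_deriv v f).
Proof.
move=> h1 h2 /andP[q0 qp] hq hp f; set d := fun v => psi (var K v) - phi (var K v).
have hm v : ordge 1 (phi (var K v)).
  rewrite -(subrK (var K v) (phi _)); apply: ordgeD; last exact: ordge_var.
  exact: ordge_le (hq v).
have hpsi g : ordge q (psi g - g).
  apply: (alg_hom_close alg_hom_id h2) => v; first exact: ordge_var.
  rewrite -(subrKA (phi (var K v))); apply: ordgeD => //.
  exact: ordge_le (hp v).
pose L g := \sum_v d v * ps_deriv v g.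
have LD g h : L (g + h) = L g + L h.
  by rewrite /L -big_split; apply: eq_bigr => v _; rewrite derivD mulrDr.
have LM g h : L (g * h) = L g * h + g * L h.
  rewrite /L mulr_suml mulr_sumr -big_split; apply: eq_bigr => v _ /=.
  by rewrite derivM; ring.
have Lc c : L (cst s c) = 0 by rewrite /L big1 // => v _; rewrite deriv_cst mulr0.
have Lv v : L (var K v) = d v.
  rewrite /L (bigD1 v) //= deriv_var eqxx mulr1 big1 ?addr0 // => u /negbTE nu.
  by rewrite deriv_var eq_sym nu mulr0.
have LS (g : 'I_s -> ps K s) : L (\sum_v g v) = \sum_v L (g v).
  by apply: (big_morph L LD); rewrite -(rmorph0 (@cst K s)) Lc rmorph0.
have Lp g : ordge p (L g).
  by apply: ordge_sum => v _; apply: ordgeMr; exact: hp.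
rewrite -/(L f); suff H k : ordge (minn (p + q) k) (psi f - phi f - L f).
  by rewrite -[(p + q)%N]minnn.
elim: k f => [|k IH] f; first by rewrite minn0; exact: ordge0n.
have [g E] := split_const f.
rewrite (alg_hom_split h1 E) (alg_hom_split h2 E) opprD addrACA subrr add0r -sumrB.
rewrite {1}E LD Lc add0r LS -sumrB; apply: ordge_sum => v _.
rewrite LM Lv /d.
set x := var K v; set y := psi x; set z := phi x.
have -> : y * psi (g v) - z * phi (g v) - ((y - z) * g v + x * L (g v)) =
   (y - z) * (psi (g v) - g v) + z * (psi (g v) - phi (g v) - L (g v)) +
   (z - x) * L (g v) by ring.
apply: ordgeD; first apply: ordgeD.
- apply: (@ordge_le _ _ _ (p + q)); first by lia.
  by apply: ordgeM; [exact: hp | exact: hpsi].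
- by apply: (@ordge_le _ _ _ (1 + minn (p + q) k)); [lia | apply: ordgeM => //; exact: hm].
- apply: (@ordge_le _ _ _ (q + p)); first by lia.
  by apply: ordgeM; [exact: hq | exact: Lp].
Qed.

(** Triviality of [phi] on every [m^n / m^(n+1)] is what gives injectivity and, by repeatedly adding
    the defect to an approximate preimage, surjectivity in [alg_hom_bij]. *)
Lemma alg_hom_raise phi : alg_hom phi ->
  (forall v, ordge 2 (phi (var K v) - var K v)) ->
  forall n f, ordge n f -> ordge n.+1 (phi f - f).
Proof.
move=> hphi h2; elim=> [|n IH] f hf.
  apply: (alg_hom_close alg_hom_id hphi) => v; first exact: ordge_var.
  by apply: ordge_le (h2 v).
have [g [-> hg]] := split_ordgeS hf.
rewrite (alg_hom_sum hphi) -sumrB; apply: ordge_sum => v _.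
have -> : phi (var K v * g v) - var K v * g v =
  (phi (var K v) - var K v) * phi (g v) + var K v * (phi (g v) - g v).
  by case: hphi => _ -> _; ring.
have IHv := IH _ (hg v).
apply: ordgeD; last by rewrite -add1n; apply: ordgeM => //; exact: ordge_var.
rewrite -[n.+2]add2n; apply: ordgeM => //; rewrite -(subrK (g v) (phi _)).
by apply: ordgeD => //; apply: ordge_le IHv.
Qed.

Lemma alg_hom_bij phi : alg_hom phi ->
  (forall v, ordge 2 (phi (var K v) - var K v)) -> bijective phi.
Proof.
move=> hphi h2; have raise := alg_hom_raise hphi h2.
have ord n f : ordge n f -> ordge n (phi f).
  move=> hf; rewrite -(subrK f (phi f)); apply: ordgeD => //.
  by apply: ordge_le (raise _ _ hf).
have inj : injective phi.
  move=> f g E; apply/eqP; rewrite -subr_eq0; apply/eqP/ordge_eq0.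
  have E0 : phi (f - g) = 0 by rewrite (alg_homB hphi) E subrr.
  elim=> [|n IH]; first exact: ordge0n.
  by have := ordgeN (raise _ _ IH); rewrite E0 sub0r opprK.
have surj g : exists f, phi f = g.
  pose u := fix u n := if n is n'.+1 then u n' + (g - phi (u n')) else 0.
  have hu n : ordge n (g - phi (u n)).
    elim: n => [|n IH]; first exact: ordge0n.
    have -> : g - phi (u n.+1) = - (phi (g - phi (u n)) - (g - phi (u n))).
      by case: (hphi) => hD _ _; rewrite [u n.+1]/(u n + (g - phi (u n))) (hD (u n)); ring.
    by apply: ordgeN; exact: raise.
  have [n|l hl] := @ps_lim _ _ u; first by rewrite /= addrAC subrr add0r.
  exists l; apply/eqP; rewrite -subr_eq0; apply/eqP/ordge_eq0 => n.
  have -> : phi l - g = phi (l - u n) - (g - phi (u n)) by rewrite (alg_homB hphi); ring.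
  by apply: ordgeB => //; apply: ord.
have [psi hpsi] := choice surj.
by exists psi => // f; apply: inj; rewrite hpsi.
Qed.

Lemma Kalg_autP phi : is_Kalg_aut phi <-> alg_hom phi /\ bijective phi.
Proof.
split=> [[hD hZ hM h1 hb]|[[hD hM hc] hb]].
  split=> //; split=> // c.
  have -> : cst s c = ps_scale c (@ps1 K s) by rewrite ps_scaleE mulr1.
  by rewrite hZ h1.
split=> //.
- by move=> c f; rewrite !ps_scaleE hM hc.
- by have := hc 1; rewrite rmorph1.
Qed.

(** A nonzero constant term would make [phi f] a unit; pulling its inverse back would make [f] a
    unit. *)
Lemma alg_hom_bij_m phi f : alg_hom phi -> bijective phi -> ordge 1 f -> ordge 1 (phi f).
Proof.
move=> [hD hM hc] [psi psiK phiK] /in_mE hf; apply/in_mE/eqP/negP=> /negP /ps_unit [g hg].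
have E : f * psi g = 1.
  apply: (can_inj psiK); rewrite hM phiK hg; symmetry.
  by have := hc 1; rewrite rmorph1.
have := congr1 (fun h : ps K s => h (mzero s)) E; rewrite coef1 eqxx.
have := ordgeMr (psi g) (proj1 (in_mE f) hf); rewrite /ordge => ->; last by rewrite mdeg0.
by move/eqP; rewrite eq_sym oner_eq0.
Qed.

End AlgebraMorphisms.

(** * The tangent image *)

Section MatrixOperations.
Variables (K : fieldType) (s : nat).
Implicit Types (A B M X Y : 'M[ps K s]_2).

Lemma mx_mulE A B : mx_mul A B = A *m B.
Proof.
apply/matrixP=> i j; rewrite !mxE; apply/funext=> a.
by rewrite coef_sum.
Qed.

Lemma mx_addE A B : mx_add A B = A + B.
Proof. by apply/matrixP=> i j; rewrite !mxE. Qed.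

Lemma mx_subE A B : mx_sub A B = A - B.
Proof. by apply/matrixP=> i j; rewrite !mxE. Qed.

Lemma mx_rscaleE r A : mx_rscale r A = r *: A.
Proof. by apply/matrixP=> i j; rewrite !mxE. Qed.

Lemma mx_KscaleE c A : mx_Kscale c A = cst s c *: A.
Proof. by apply/matrixP=> i j; rewrite !mxE ps_scaleE. Qed.

Lemma mx_sumE (I : finType) (F : I -> 'M[ps K s]_2) : mx_sum F = \sum_i F i.
Proof.
apply/matrixP=> i j; rewrite !mxE summxE; apply/funext=> a.
by rewrite coef_sum.
Qed.

Lemma mx_idE : @mx_id K s = 1%:M.
Proof. by apply/matrixP=> i j; rewrite !mxE; case: eqP. Qed.

Lemma EpqE p q : @Epq K s p q = delta_mx p q.
Proof. by apply/matrixP=> i j; rewrite !mxE; case: ifP. Qed.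

Definition dmx v A : 'M[ps K s]_2 := map_mx (ps_deriv v) A.

Lemma mx_derivE v A : mx_deriv v A = dmx v A.
Proof. by apply/matrixP=> i j; rewrite !mxE. Qed.

Lemma mx_mapE phi A : mx_map phi A = map_mx phi A.
Proof. by apply/matrixP=> i j; rewrite !mxE. Qed.

Lemma dmxM v A B : dmx v (A *m B) = dmx v A *m B + A *m dmx v B.
Proof.
apply/matrixP=> i j; rewrite !mxE deriv_sum -big_split; apply: eq_bigr => k _ /=.
by rewrite derivM !mxE.
Qed.

Lemma dmxD v A B : dmx v (A + B) = dmx v A + dmx v B.
Proof. by apply/matrixP=> i j; rewrite !mxE derivD. Qed.

Definition mordge n M := forall i j, ordge n (M i j).
Definition mdeglt n M := forall i j, deglt n (M i j).

Lemma mordgeD n A B : mordge n A -> mordge n B -> mordge n (A + B).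
Proof. by move=> h1 h2 i j; rewrite mxE; apply: ordgeD. Qed.

Lemma mordgeN n A : mordge n A -> mordge n (- A).
Proof. by move=> h1 i j; rewrite mxE; apply: ordgeN. Qed.

Lemma mordgeM n m A B : mordge n A -> mordge m B -> mordge (n + m) (A *m B).
Proof. by move=> h1 h2 i j; rewrite mxE; apply: ordge_sum => k _; apply: ordgeM. Qed.

Lemma mordge0n A : mordge 0 A. Proof. by move=> i j; exact: ordge0n. Qed.

Lemma mordge_le m n A : (m <= n)%N -> mordge n A -> mordge m A.
Proof. by move=> mn h i j; apply: ordge_le mn (h i j). Qed.

Lemma mordge_eq0 A : (forall n, mordge n A) -> A = 0.
Proof. by move=> h; apply/matrixP=> i j; rewrite mxE; apply: ordge_eq0 => n; apply: h. Qed.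

Lemma mordge_0 n : mordge n 0.
Proof. by move=> i j; rewrite mxE; exact: ordge_0. Qed.

End MatrixOperations.

Section Tangent.
Variables (K : fieldType) (s : nat) (A : 'M[ps K s]_2).
Implicit Types (M X Y : 'M[ps K s]_2) (f : 'I_s -> ps K s).

(** The linear part at the identity of the group action [act] below, in the direction
    [(X, Y, f)]. *)
Definition tgt X Y f : 'M[ps K s]_2 :=
  X *m A + A *m Y + \sum_v f v *: dmx v A.

Lemma tgtD X Y f X' Y' f' :
  tgt (X + X') (Y + Y') (fun v => f v + f' v) = tgt X Y f + tgt X' Y' f'.
Proof.
rewrite /tgt mulmxDl mulmxDr; under eq_bigr do rewrite scalerDl.
rewrite big_split /= (addrACA (X *m A) (X' *m A)).
by rewrite (addrACA (X *m A + A *m Y)).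
Qed.

Lemma tgtZ r X Y f : tgt (r *: X) (r *: Y) (fun v => r * f v) = r *: tgt X Y f.
Proof.
rewrite /tgt !scalerDr scalemxAl scalemxAr scaler_sumr.
by congr (_ + _); apply: eq_bigr => v _; rewrite scalerA.
Qed.

(* Membership in m^n times the tangent image, with a witness of the right order;
   [n = 0] is plain membership. *)
Definition tanord n M := exists X Y f,
  [/\ mordge n X, mordge n Y, forall v, ordge n.+1 (f v) & M = tgt X Y f].

Lemma tanordD n M M' : tanord n M -> tanord n M' -> tanord n (M + M').
Proof.
move=> [X [Y [f [hX hY hf ->]]]] [X' [Y' [f' [hX' hY' hf' ->]]]].
exists (X + X'), (Y + Y'), (fun v => f v + f' v); split; last by rewrite tgtD.
- exact: mordgeD.
- exact: mordgeD.
- by move=> v; apply: ordgeD.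
Qed.

Lemma tanord0 n : tanord n 0.
Proof.
exists 0, 0, (fun=> 0); split; [exact: mordge_0 | exact: mordge_0 | |].
  by move=> v; exact: ordge_0.
by rewrite /tgt mul0mx mulmx0 big1 ?addr0 // => v _; rewrite scale0r.
Qed.

Lemma tanord_sum n (I : Type) (r : seq I) (P : pred I) (F : I -> 'M[ps K s]_2) :
  (forall i, P i -> tanord n (F i)) -> tanord n (\sum_(i <- r | P i) F i).
Proof.
by move=> h; elim/big_rec: _ => [|i M Pi hM]; [exact: tanord0 | apply: tanordD => //; apply: h].
Qed.

Lemma tanordZ n m r M : ordge n r -> tanord m M -> tanord (n + m) (r *: M).
Proof.
move=> hr [X [Y [f [hX hY hf ->]]]].
exists (r *: X), (r *: Y), (fun v => r * f v); split; last by rewrite tgtZ.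
- by move=> i j; rewrite mxE; apply: ordgeM.
- by move=> i j; rewrite mxE; apply: ordgeM.
- by move=> v; rewrite -addnS; apply: ordgeM.
Qed.

Lemma tanordZ0 r M : tanord 0 M -> tanord 0 (r *: M).
Proof. exact: (tanordZ (ordge0n r)). Qed.

Lemma tanordN M : tanord 0 M -> tanord 0 (- M).
Proof. by move=> h; rewrite -scaleN1r; apply: tanordZ0. Qed.

Lemma tanordB M M' : tanord 0 M -> tanord 0 M' -> tanord 0 (M - M').
Proof. by move=> h h'; apply: tanordD => //; apply: tanordN. Qed.

Lemma tanord_left X : tanord 0 (X *m A).
Proof.
exists X, 0, (fun=> 0); split; try exact: mordge0n; try (by move=> v; exact: ordge_0).
by rewrite /tgt mulmx0 big1 ?addr0 // => v _; rewrite scale0r.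
Qed.

Lemma tanord_right Y : tanord 0 (A *m Y).
Proof.
exists 0, Y, (fun=> 0); split; try exact: mordge0n; try (by move=> v; exact: ordge_0).
by rewrite /tgt mul0mx add0r big1 ?addr0 // => v _; rewrite scale0r.
Qed.

Lemma tanord_deriv v r : ordge 1 r -> tanord 0 (r *: dmx v A).
Proof.
move=> hr; exists 0, 0, (fun u => if u == v then r else 0).
split; try exact: mordge0n.
  by move=> u; case: eqP => // _; exact: ordge_0.
rewrite /tgt mul0mx mulmx0 !add0r (bigD1 v) //= eqxx big1 ?addr0 // => u /negbTE ->.
by rewrite scale0r.
Qed.

Lemma in_tangentE M : in_tangent A M <-> tanord 0 M.
Proof.
split.
  case=> c [d [f [hf ->]]]; rewrite !mx_addE !mx_sumE.
  apply: tanordD; first apply: tanordD; apply: tanord_sum.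
  - by move=> p _; rewrite mx_rscaleE mx_mulE EpqE; apply/tanordZ0/tanord_left.
  - by move=> p _; rewrite mx_rscaleE mx_mulE EpqE; apply/tanordZ0/tanord_right.
  - by move=> v _; rewrite mx_rscaleE mx_derivE; apply: tanord_deriv; apply/in_mE.
case=> X [Y [f [_ _ hf ->]]].
exists (fun i j => X i j), (fun i j => Y i j), f; split; first by move=> v; apply/in_mE.
rewrite !mx_addE !mx_sumE; congr (_ + _ + _).
- rewrite {1}(matrix_sum_delta X) mulmx_suml -(pair_bigA _ (fun i j =>
    mx_rscale (X i j) (mx_mul (Epq K s i j) A))); apply: eq_bigr => i _.
  rewrite mulmx_suml; apply: eq_bigr => j _.
  by rewrite mx_rscaleE mx_mulE EpqE scalemxAl.
- rewrite {1}(matrix_sum_delta Y) mulmx_sumr -(pair_bigA _ (fun i j =>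
    mx_rscale (Y i j) (mx_mul A (Epq K s i j)))); apply: eq_bigr => i _.
  rewrite mulmx_sumr; apply: eq_bigr => j _.
  by rewrite mx_rscaleE mx_mulE EpqE scalemxAr.
- by apply: eq_bigr => v _; rewrite mx_rscaleE mx_derivE.
Qed.

Lemma finite_codimE : finite_codim_tangent A <->
  exists (n : nat) (B : 'I_n -> 'M[ps K s]_2), forall M, exists a : 'I_n -> K,
    tanord 0 (M - \sum_i cst s (a i) *: B i).
Proof.
have E n (B : 'I_n -> 'M[ps K s]_2) M a :
    mx_sub M (mx_sum (fun i => mx_Kscale (a i) (B i))) = M - \sum_i cst s (a i) *: B i.
  by rewrite mx_subE mx_sumE; congr (_ - _); apply: eq_bigr => i _; rewrite mx_KscaleE.
split=> -[n [B h]]; exists n, B => M; have [a ha] := h M; exists a.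
  by apply/in_tangentE; rewrite -E.
by apply/in_tangentE; rewrite E.
Qed.

Lemma coef_varX0 (v : 'I_s) n : (var K v ^+ n : ps K s) (mzero s) = (n == 0%N)%:R.
Proof.
case: n => [|n]; first by rewrite expr0 coef1 eqxx.
by rewrite (@ordgeX _ _ n.+1 _ (ordge_var K v)) // mdeg0.
Qed.

(* Finitely many classes make the powers [x_v^m M] linearly dependent modulo the tangent
   image, and a nonzero polynomial in [x_v] is a power of [x_v] times a unit. *)
Lemma tangent_var_power n (B : 'I_n -> 'M[ps K s]_2) v M :
  (forall m, exists a : 'I_n -> K,
     tanord 0 (var K v ^+ m *: M - \sum_i cst s (a i) *: B i)) ->
  exists D, tanord 0 (var K v ^+ D *: M).
Proof.
move=> /choice [a ha]; pose C : 'M[K]_(n.+1, n) := \matrix_(m, i) a m i.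
have kerC : kermx C != 0.
  by rewrite -mxrank_eq0 mxrank_ker -lt0n subn_gt0 ltnS rank_leq_col.
have /rowV0Pn [u /sub_kermxP uC u0] := kerC.
have [m0 hm0] : exists m, u 0 m != 0.
  apply/existsP; apply: contraNT u0; rewrite negb_exists => /forallP h.
  by apply/eqP/rowP=> m; rewrite mxE; apply/eqP; rewrite -[_ == _]negbK.
(* The lowest exponent in the relation: after [x_v^k] is factored out, the constant term of the
   cofactor is [u 0 k], which is nonzero. *)
pose k := [arg min_(m < m0 | u 0 m != 0) (m : nat)].
have [uk kmin] : u 0 k != 0 /\ forall m, u 0 m != 0 -> (k <= m)%N.
  by rewrite /k; case: arg_minnP => // m hm hmin; split.
pose p := \sum_m cst s (u 0 m) * var K v ^+ m.
have pT : tanord 0 (p *: M).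
  have -> : p *: M = \sum_m cst s (u 0 m) *:
      (var K v ^+ m *: M - \sum_i cst s (a m i) *: B i).
    under [RHS]eq_bigr => m _ do rewrite scalerBr scalerA.
    rewrite sumrB -scaler_suml -/p.
    under [X in _ - X]eq_bigr => m _ do rewrite scaler_sumr.
    rewrite exchange_big /= [X in _ - X]big1 ?subr0 // => i _.
    under eq_bigr => m _ do rewrite scalerA -rmorphM.
    rewrite -scaler_suml -rmorph_sum /=.
    have -> : \sum_m u 0 m * a m i = (u *m C) 0 i.
      by rewrite mxE; apply: eq_bigr => m _; rewrite mxE.
    by rewrite uC mxE rmorph0 scale0r.
  by apply: tanord_sum => m _; apply: tanordZ0; apply: ha.
(* For [m < k] the subtraction truncates, but then [u 0 m] vanishes. *)
pose q := \sum_m cst s (u 0 m) * var K v ^+ (m - k).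
have pq : p = var K v ^+ k * q.
  rewrite /p /q mulr_sumr; apply: eq_bigr => m _.
  case: (eqVneq (u 0 m) 0) => [->|/kmin km]; first by rewrite rmorph0 !mul0r mulr0.
  by rewrite mulrCA -exprD subnKC.
have /ps_unit [g qg] : q (mzero s) != 0.
  rewrite /q coef_sum (bigD1 k) //= cstM coef_varX0 subnn eqxx mulr1 big1 ?addr0 //.
  move=> m mk; rewrite cstM coef_varX0.
  case: (eqVneq (u 0 m) 0) => [->|/kmin km]; first by rewrite mul0r.
  rewrite subn_eq0 leqNgt ltn_neqAle km andbT eq_sym; move: mk; rewrite -val_eqE /= => ->.
  by rewrite mulr0.
exists k; have -> : var K v ^+ k *: M = g *: (p *: M).
  by rewrite scalerA pq mulrCA [g * q]mulrC qg mulr1.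
exact: tanordZ0.
Qed.

(** The quantitative form of finite codimension; [finite_codim_cofinal] and [cofinal_finite_codim]
    are the two directions. *)
Definition cofinal D := forall v i j, tanord 0 (var K v ^+ D *: delta_mx i j).

Lemma cofinal_uniform :
  (forall v i j, exists D, tanord 0 (var K v ^+ D *: delta_mx i j)) ->
  exists D, cofinal D.
Proof.
move=> h.
have [D hD] := choice (fun p : 'I_s * 'I_2 * 'I_2 => h p.1.1 p.1.2 p.2).
exists (\max_p D p) => v i j.
rewrite -(subnK (leq_bigmax (v, i, j))) exprD -scalerA; apply: tanordZ0.
exact: (hD (v, i, j)).
Qed.

Lemma finite_codim_cofinal : finite_codim_tangent A -> exists D, cofinal D.
Proof.
move=> /finite_codimE [n [B h]]; apply: cofinal_uniform => v i j.
exact: (@tangent_var_power n B).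
Qed.

(** The summands of the bound have separate purposes: degree above [s * D] forces some exponent to
    be at least [D], the next [D] pays for dividing by [x_v^D], and order [n] remains for the
    coefficients. *)
Lemma tanord_cofinal D n M : cofinal D -> mordge ((s * D).+1 + D + n) M -> tanord n M.
Proof.
move=> hD hM; rewrite (matrix_sum_delta M); apply: tanord_sum => i _; apply: tanord_sum => j _.
have [a|g [E hg _]] := @split_vars _ _ D (M i j).
  move=> h; apply: exists_large_exponent; rewrite ltnNge; apply: contra h => h.
  by rewrite hM //; lia.
rewrite E scaler_suml; apply: tanord_sum => v _; rewrite mulrC -scalerA -[n]addn0.
apply: tanordZ; last exact: hD.
by apply: (ordge_le _ (hg _ (hM i j) v)); lia.
Qed.

End Tangent.

(** * Truncation and finite codimension *)

Section Truncation.
Variables (K : fieldType) (s : nat).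
Implicit Types (f : ps K s) (M A : 'M[ps K s]_2).

Definition trunc n f : ps K s := fun a => if (mdeg a < n)%N then f a else 0.

Lemma deglt_trunc n f : deglt n (trunc n f).
Proof. by move=> a an; rewrite /trunc ltnNge an. Qed.

Lemma ordge_trunc n f : ordge n (f - trunc n f).
Proof. by move=> a an; rewrite coefB /trunc an subrr. Qed.

Lemma deglt_sum_mon n f : deglt n f -> f = \sum_(b <- mons s n) cst s (f b) * mon K b.
Proof.
move=> h; apply/funext=> a; rewrite coef_sum.
under eq_bigr => b _ do rewrite cstM /mon.
case: (leqP (mdeg a) n) => an.
  rewrite (bigD1_seq a) ?mons_uniq ?mdeg_mons //= eqxx mulr1 big1 ?addr0 // => b.
  by rewrite eq_sym => /negbTE ->; rewrite mulr0.
rewrite (h a (ltnW an)) big1 // => b _; case: eqP => [<-|_]; last by rewrite mulr0.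
by rewrite (h a (ltnW an)) mul0r.
Qed.

Lemma mdeglt_span n : exists (k : nat) (B : 'I_k -> 'M[ps K s]_2),
  forall M, mdeglt n M -> exists a : 'I_k -> K, M = \sum_i cst s (a i) *: B i.
Proof.
pose T := ('I_2 * 'I_2 * {ffun 'I_s -> 'I_n.+1})%type.
pose F (x : T) : 'M[ps K s]_2 := mon K (ord_to_mono x.2) *: delta_mx x.1.1 x.1.2.
exists #|{: T}|, (fun i => F (enum_val i)) => M hM.
exists (fun i => M (enum_val i).1.1 (enum_val i).1.2 (ord_to_mono (enum_val i).2)).
rewrite -(big_enum_val (fun x : T => cst s (M x.1.1 x.1.2 (ord_to_mono x.2)) *: F x)).
rewrite /= -(pair_bigA _ (fun p b => cst s (M p.1 p.2 (ord_to_mono b)) *: F (p, b))) /=.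
rewrite -(pair_bigA _ (fun i j => \sum_b cst s (M i j (ord_to_mono b)) *: F (i, j, b))) /=.
rewrite {1}(matrix_sum_delta M); apply: eq_bigr => i _; apply: eq_bigr => j _.
rewrite {1}(deglt_sum_mon (hM i j)) scaler_suml /mons big_map big_enum /=.
by apply: eq_bigr => b _; rewrite /F scalerA.
Qed.

Lemma cofinal_finite_codim A D : cofinal A D -> finite_codim_tangent A.
Proof.
move=> hD; apply/finite_codimE; set n := ((s * D).+1 + D + 0)%N.
have [k [B hB]] := mdeglt_span n; exists k, B => M.
have [|a ha] := hB (map_mx (trunc n) M).
  by move=> i j; rewrite mxE; exact: deglt_trunc.
exists a; rewrite -ha; apply: tanord_cofinal hD _ => i j.
by rewrite !mxE; exact: ordge_trunc.
Qed.

End Truncation.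

(** * Finite codimension implies finite determinacy *)

Lemma addmxE (R : nmodType) m n (M N : 'M[R]_(m, n)) i j : (M + N) i j = M i j + N i j.
Proof. exact: mxE. Qed.

Lemma oppmxE (R : zmodType) m n (M : 'M[R]_(m, n)) i j : (- M) i j = - M i j.
Proof. exact: mxE. Qed.

(** Matrix products do not commute, so they are first expanded; [ring] then sees their entries as
    atoms and settles only an additive identity. *)
Ltac mx_ring :=
  rewrite ?(mulmxDl, mulmxDr, mulmxN, mulNmx, mul1mx, mulmx1, mulmxA);
  apply/matrixP=> ? ?; rewrite ?(addmxE, oppmxE); ring.

Section MatrixIdentities.
Variables (R : comNzRingType) (n : nat).
Implicit Types A P Q S X Y : 'M[R]_n.

Lemma conj_diff P Q X Y X' Y' :
  (1%:M + X') *m P *m (1%:M + Y') - (1%:M + X) *m Q *m (1%:M + Y) =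
  (X' - X) *m (P *m (1%:M + Y')) + ((1%:M + X) *m (P - Q)) *m (1%:M + Y') +
  ((1%:M + X) *m Q) *m (Y' - Y).
Proof. mx_ring. Qed.

(** Here [P] and [Q] stand for [A] after the new and the old substitution, and [S] for the
    first-order effect of the change. Apart from the Taylor remainder [P - Q - S], every summand on
    the right contains two small factors. *)
Lemma conj_diff2 A P Q S X Y dX dY :
  (1%:M + (X + dX)) *m P *m (1%:M + (Y + dY)) - (1%:M + X) *m Q *m (1%:M + Y)
   - (dX *m A + A *m dY + S) =
  dX *m (P - A) + dX *m P *m (Y + dY) + (P - Q - S) + (P - Q) *m Y
  + X *m ((P - Q) *m (1%:M + Y)) + (P - A) *m dY + X *m P *m dY.
Proof. mx_ring. Qed.

End MatrixIdentities.

Section Determinacy.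
Variables (K : fieldType) (s : nat).
Implicit Types (A B M X Y U : 'M[ps K s]_2) (f : 'I_s -> ps K s).


Definition coef_mzero (g : ps K s) : K := g (mzero s).

Lemma coef_mzero_zmod_morphism : zmod_morphism coef_mzero.
Proof. by []. Qed.

Lemma coef_mzero_monoid_morphism : monoid_morphism coef_mzero.
Proof.
split=> [|g h]; first by rewrite /coef_mzero coef1 eqxx.
have hg : ordge 1 (g - cst s (g (mzero s))).
  by apply/in_mE; rewrite /in_m coefB coef_cst eqxx subrr.
rewrite -{1}(subrK (cst s (g (mzero s))) g) mulrDl /coef_mzero coefD cstM.
by rewrite (ordgeMr h hg) ?mdeg0 ?add0r.
Qed.

HB.instance Definition _ := GRing.isZmodMorphism.Build (ps K s) K coef_mzero
  coef_mzero_zmod_morphism.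
HB.instance Definition _ := GRing.isMonoidMorphism.Build (ps K s) K coef_mzero
  coef_mzero_monoid_morphism.

Lemma GL2_near1 U : mordge 1 (U - 1%:M) -> in_GL2 U.
Proof.
move=> h; have E : map_mx coef_mzero U = 1%:M.
  rewrite -(subrK 1%:M U) map_mxD map_mx1; apply/matrixP=> i j; rewrite addmxE.
  by rewrite [X in X + _]mxE /= /coef_mzero (h i j) ?mdeg0 ?add0r.
have [|g hg] := @ps_unit _ _ (\det U).
  by rewrite -[X in X != _]/(coef_mzero (\det U)) -det_map_mx E det1 oner_eq0.
exists (g *: \adj U); rewrite !mx_mulE mx_idE -scalemxAr -scalemxAl mul_mx_adj mul_adj_mx.
by rewrite scale_scalar_mx mulrC hg.
Qed.

Lemma mx_lim (u : nat -> 'M[ps K s]_2) : (forall n, mordge n (u n.+1 - u n)) ->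
  exists l, forall n, mordge n (l - u n).
Proof.
move=> hu; have H (p : 'I_2 * 'I_2) : exists l, forall n, ordge n (l - u n p.1 p.2).
  by apply: ps_lim => n; have := hu n p.1 p.2; rewrite !mxE.
have [l hl] := choice H; exists (\matrix_(i, j) l (i, j)) => n i j.
by rewrite !mxE; exact: (hl (i, j)).
Qed.

Definition shift f := subst (fun v => var K v + f v).

Definition act A X Y f := (1%:M + X) *m map_mx (shift f) A *m (1%:M + Y).

Section Shift.
Variable f : 'I_s -> ps K s.
Hypothesis hf : forall v, ordge 1 (f v).

Lemma alg_hom_shift : alg_hom (shift f).
Proof. by apply: alg_hom_subst => v; apply: ordgeD => //; exact: ordge_var. Qed.

Lemma shift_var v : shift f (var K v) = var K v + f v.
Proof. by apply: subst_var => u; apply: ordgeD => //; exact: ordge_var. Qed.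

End Shift.

Lemma shift_close n f f' g : (forall v, ordge 1 (f v)) -> (forall v, ordge 1 (f' v)) ->
  (forall v, ordge n (f' v - f v)) -> ordge n (shift f' g - shift f g).
Proof.
move=> hf hf' h; apply: alg_hom_close; try exact: alg_hom_shift.
  by move=> v; rewrite shift_var //; apply: ordgeD => //; exact: ordge_var.
by move=> v; rewrite !shift_var // opprD addrACA subrr add0r.
Qed.

Lemma act_close n A X Y f X' Y' f' :
  (forall v, ordge 1 (f v)) -> (forall v, ordge 1 (f' v)) ->
  mordge n (X' - X) -> mordge n (Y' - Y) -> (forall v, ordge n (f' v - f v)) ->
  mordge n (act A X' Y' f' - act A X Y f).
Proof.
move=> hf hf' hX hY h; rewrite /act; set P := map_mx (shift f') A; set Q := map_mx _ A.
have hPQ : mordge n (P - Q) by move=> i j; rewrite !mxE; exact: shift_close.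
rewrite conj_diff.
apply: mordgeD; first apply: mordgeD.
- by rewrite -[n]addn0; apply: mordgeM => //; exact: mordge0n.
- rewrite -[n]addn0; apply: mordgeM; last exact: mordge0n.
  by rewrite -[n]add0n; apply: mordgeM => //; exact: mordge0n.
- by rewrite -[n]add0n; apply: mordgeM => //; exact: mordge0n.
Qed.

(** A step of order [i] taken at distance [j] from the identity has linearisation error [i + j + 1].
    The extra one comes from [A] lying in [m] and from the substitutions being one order smaller
    than the matrices; it is the gain that drives the iteration. *)
Lemma act_taylor i j A X Y f dX dY df : (j <= i)%N -> mordge 1 A ->
  mordge j X -> mordge j Y -> (forall v, ordge j.+1 (f v)) ->
  mordge i dX -> mordge i dY -> (forall v, ordge i.+1 (df v)) ->
  mordge (i + j).+1 (act A (X + dX) (Y + dY) (fun v => f v + df v) - act A X Y f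
                     - tgt A dX dY df).
Proof.
move=> ji hA hX hY hf hdX hdY hdf.
have hf1 v : ordge 1 (f v) by apply: ordge_le (hf v).
have hdf1 v : ordge 1 (df v) by apply: ordge_le (hdf v).
have hf' v : ordge 1 (f v + df v) by apply: ordgeD.
rewrite /act /tgt; set P := map_mx (shift (fun v => f v + df v)) A; set Q := map_mx _ A.
set S := \sum_v _.
have hPQ : mordge i.+1 (P - Q).
  move=> k l; rewrite !mxE; apply: shift_close => // v.
  by rewrite addrAC subrr add0r.
have hQA : mordge j.+1 (Q - A).
  move=> k l; rewrite !mxE; apply: (alg_hom_close (@alg_hom_id K s) (alg_hom_shift hf1)).
    exact: ordge_var.
  by move=> v; rewrite shift_var // addrAC subrr add0r.
have hPA : mordge j.+1 (P - A).
  rewrite -(subrKA Q); apply: mordgeD => //; apply: mordge_le hPQ; lia.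
have hP : mordge 1 P.
  rewrite -(subrK A P); apply: mordgeD => //; apply: mordge_le hPA; lia.
have hPQS : mordge (i + j).+1 (P - Q - S).
  move=> k l; rewrite /S !mxE summxE.
  have T := @alg_hom_taylor _ _ i.+1 j.+1 _ _ (alg_hom_shift hf1) (alg_hom_shift hf').
  apply: (@ordge_le _ _ _ (i.+1 + j.+1)); first by lia.
  have -> : \sum_v (df v *: dmx v A) k l =
      \sum_v (shift (fun u => f u + df u) (var K v) - shift f (var K v)) *
        ps_deriv v (A k l).
    by apply: eq_bigr => v _; rewrite !mxE !shift_var // opprD addrACA subrr add0r
      addrAC subrr add0r.
  apply: T; first by rewrite /= ltnS.
    by move=> v; rewrite shift_var // addrAC subrr add0r.
  move=> v; rewrite !shift_var // opprD addrACA subrr add0r.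
  by rewrite addrAC subrr add0r.
rewrite conj_diff2.
have hYdY : mordge j (Y + dY) by apply: mordgeD => //; exact: mordge_le hdY.
apply: mordgeD; last first.
  have -> : (i + j).+1 = (j + 1 + i)%N by lia.
  by apply: mordgeM => //; apply: mordgeM.
apply: mordgeD; last first.
  have -> : (i + j).+1 = (j.+1 + i)%N by lia.
  by apply: mordgeM.
apply: mordgeD; last first.
  have -> : (i + j).+1 = (j + (i.+1 + 0))%N by lia.
  by apply: mordgeM => //; apply: mordgeM => //; exact: mordge0n.
apply: mordgeD; last by rewrite -addSn; apply: mordgeM.
apply: mordgeD; last exact: hPQS.
apply: mordgeD; first by rewrite -addnS; apply: mordgeM.
have -> : (i + j).+1 = (i + 1 + j)%N by lia.
by apply: mordgeM => //; apply: mordgeM.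
Qed.

(** A defect of order [2j + n] lifts to an increment of order [j + n], because [j] is the loss in
    [tanord_cofinal]. All transformations stay at distance [j] from the identity, so the new defect
    has order [(j + n) + j + 1]: one order is gained per step. *)
Lemma cofinal_determined A D : mordge 1 A -> cofinal A D ->
  G_finitely_determined A.
Proof.
move=> hA hD; set j := ((s * D).+1 + D)%N; have j0 : (0 < j)%N by [].
exists (j + j).-1; split; first by rewrite /j; lia.
rewrite /G_k_determined prednK; last by lia.
move=> B hB.
pose state := ('M[ps K s]_2 * 'M[ps K s]_2 * ('I_s -> ps K s))%type.
pose good n (w : state) := [/\ mordge j w.1.1, mordge j w.1.2,
  forall v, ordge j.+1 (w.2 v) & mordge (j + j + n) (B - act A w.1.1 w.1.2 w.2)].
pose near n (w w' : state) := [/\ mordge n (w'.1.1 - w.1.1), mordge n (w'.1.2 - w.1.2) &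
  forall v, ordge n (w'.2 v - w.2 v)].
(* The invariant is a premise, and a state violating it is returned unchanged, so that [choice]
   yields a total function to iterate. *)
have step (p : nat * state) : exists w', good p.1 p.2 -> good p.1.+1 w' /\ near p.1 p.2 w'.
  case: p => n [[X Y] f] /=.
  have [[/= hX hY hf hE]|ng] := pselect (good n (X, Y, f)); last by exists (X, Y, f).
  have [|dX [dY [df [hdX hdY hdf E]]]] := @tanord_cofinal _ _ A D (j + n) (B - act A X Y f) hD.
    by rewrite -/j addnA; exact: hE.
  exists (X + dX, Y + dY, fun v => f v + df v) => _; split; split=> /=.
  - by apply: mordgeD => //; apply: mordge_le hdX; lia.
  - by apply: mordgeD => //; apply: mordge_le hdY; lia.
  - by move=> v; apply: ordgeD => //; apply: ordge_le (hdf v); lia.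
  - have -> : B - act A (X + dX) (Y + dY) (fun v => f v + df v) =
      - (act A (X + dX) (Y + dY) (fun v => f v + df v) - act A X Y f - tgt A dX dY df).
      by rewrite -E (opprB B) subrKA opprB.
    apply: mordgeN; apply: (@mordge_le _ _ _ ((j + n) + j).+1); first by lia.
    by apply: act_taylor => //; lia.
  - by rewrite addrAC subrr add0r; apply: mordge_le hdX; lia.
  - by rewrite addrAC subrr add0r; apply: mordge_le hdY; lia.
  - by move=> v; rewrite addrAC subrr add0r; apply: ordge_le (hdf v); lia.
have [next hnext] := choice step.
pose w := fix w n : state := if n is n'.+1 then next (n', w n') else (0, 0, fun=> 0).
have hw n : good n (w n).
  elim: n => [|n IH]; last by case: (hnext (n, w n) IH).
  split=> /=; try exact: mordge_0; first by move=> v; exact: ordge_0.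
  have -> : act A 0 0 (fun=> 0) = A.
    rewrite /act !addr0 mul1mx mulmx1; apply/matrixP=> k l; rewrite mxE.
    apply/eqP; rewrite -subr_eq0; apply/eqP/ordge_eq0 => n.
    have h0 (v : 'I_s) : ordge 1 (0 : ps K s) by exact: ordge_0.
    apply: (alg_hom_close (@alg_hom_id K s) (@alg_hom_shift (fun=> 0) h0)).
      exact: ordge_var.
    by move=> v; rewrite shift_var // addr0 subrr; exact: ordge_0.
  move=> k l; rewrite addn0; have := hB k l; rewrite in_mpowE.
  by rewrite mx_subE.
have hnear n : near n (w n) (w n.+1) by case: (hnext (n, w n) (hw n)).
have [n|X hX] := @mx_lim (fun n => (w n).1.1); first by case: (hnear n).
have [n|Y hY] := @mx_lim (fun n => (w n).1.2); first by case: (hnear n).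
have [f hf] : exists f : 'I_s -> ps K s, forall v n, ordge n (f v - (w n).2 v).
  have h v : exists g, forall n, ordge n (g - (w n).2 v).
    by apply: ps_lim => n; case: (hnear n).
  by have [f hf] := choice h; exists f.
have hX1 : mordge 1 X.
  rewrite -(subrK (w j).1.1 X); apply: mordgeD; first by apply: mordge_le (hX j).
  by case: (hw j) => h _ _ _; apply: mordge_le h.
have hY1 : mordge 1 Y.
  rewrite -(subrK (w j).1.2 Y); apply: mordgeD; first by apply: mordge_le (hY j).
  by case: (hw j) => _ h _ _; apply: mordge_le h.
(* Order two, available because [j > 0], is what makes the limit substitution bijective. *)
have hf2 v : ordge 2 (f v).
  rewrite -(subrK ((w j.+1).2 v) (f v)); apply: ordgeD; first by apply: ordge_le (hf v j.+1).
  by case: (hw j.+1) => _ _ h _; apply: ordge_le (h v).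
have hf1 v : ordge 1 (f v) by apply: ordge_le (hf2 v).
exists (1%:M + X), (1%:M + Y), (shift f); split.
- by apply: GL2_near1; rewrite addrAC subrr add0r.
- by apply: GL2_near1; rewrite addrAC subrr add0r.
- apply/Kalg_autP; split; first exact: alg_hom_shift.
  apply: alg_hom_bij; first exact: alg_hom_shift.
  by move=> v; rewrite shift_var // addrAC subrr add0r.
rewrite !mx_mulE mx_mapE -/(act A X Y f).
apply/eqP; rewrite -subr_eq0; apply/eqP/mordge_eq0 => n.
rewrite -(subrKA (act A (w n).1.1 (w n).1.2 (w n).2)); case: (hw n) => _ _ hwf hwE.
apply: mordgeD; first by apply: mordge_le hwE; lia.
rewrite -opprB; apply: mordgeN; apply: act_close => //.
by move=> v; apply: ordge_le (hwf v).
Qed.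

End Determinacy.

(** * Invariance under the group *)

Section Transport.
Variables (K : fieldType) (s : nat).
Implicit Types (A B C M N X Y Z P Q : 'M[ps K s]_2) (f : 'I_s -> ps K s).

(** Only derivatives need an argument: by the product rule [P (dB) Q] differs from [d(PBQ)] by terms
    in [dP] and [dQ], which are left and right multiples of [PBQ] since [P] and [Q] are
    invertible. *)
Lemma tangent_conj B Z P P' Q Q' : P' *m P = 1%:M -> Q *m Q' = 1%:M ->
  tanord B 0 Z -> tanord (P *m B *m Q) 0 (P *m Z *m Q).
Proof.
move=> hP hQ [X [Y [f [_ _ hf ->]]]]; rewrite /tgt !mulmxDr !mulmxDl.
apply: tanordD; first apply: tanordD.
- have -> : P *m (X *m B) *m Q = (P *m X *m P') *m (P *m B *m Q).
    by rewrite !mulmxA -(mulmxA _ P' P) hP mulmx1.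
  exact: tanord_left.
- have -> : P *m (B *m Y) *m Q = (P *m B *m Q) *m (Q' *m Y *m Q).
    by rewrite !mulmxA -(mulmxA _ Q Q') hQ mulmx1.
  exact: tanord_right.
rewrite mulmx_sumr mulmx_suml; apply: tanord_sum => v _.
rewrite -scalemxAr -scalemxAl.
have -> : P *m dmx v B *m Q = dmx v (P *m B *m Q)
    - (dmx v P *m P') *m (P *m B *m Q) - (P *m B *m Q) *m (Q' *m dmx v Q).
  have -> : dmx v P *m P' *m (P *m B *m Q) = dmx v P *m B *m Q.
    by rewrite !mulmxA -(mulmxA _ P' P) hP mulmx1.
  have -> : P *m B *m Q *m (Q' *m dmx v Q) = P *m B *m dmx v Q.
    by rewrite !mulmxA -(mulmxA _ Q Q') hQ mulmx1.
  by rewrite !dmxM !mulmxDl [RHS]addrAC addrK addrAC subrr add0r.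
rewrite !scalerBr; apply: tanordB; first apply: tanordB.
- exact: tanord_deriv.
- exact/tanordZ0/tanord_left.
- exact/tanordZ0/tanord_right.
Qed.

Section AutTransport.
Variables phi psi : ps K s -> ps K s.
Hypotheses (hphi : alg_hom phi) (hpsi : alg_hom psi) (phiK : cancel phi psi)
  (psiK : cancel psi phi).

(* [psi \o ps_deriv v \o phi] is again a derivation. *)
Lemma deriv_transport v g :
  psi (ps_deriv v g) = \sum_u psi (ps_deriv v (phi (var K u))) * ps_deriv u (psi g).
Proof.
case: (hphi) => phiD phiM phic; case: (hpsi) => psiD psiM psic.
pose D h := psi (ps_deriv v (phi h)).
pose E h := \sum_u D (var K u) * ps_deriv u h.
have -> : psi (ps_deriv v g) = D (psi g) by rewrite /D psiK.
rewrite -/(E (psi g)); apply: derivation_eq.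
- by move=> a b; rewrite /D phiD derivD psiD.
- by move=> a b; rewrite /E -big_split; apply: eq_bigr => u _; rewrite derivD mulrDr.
- by move=> a b; rewrite /D phiM derivM psiD !psiM !phiK.
- move=> a b; rewrite /E mulr_suml mulr_sumr -big_split; apply: eq_bigr => u _.
  by rewrite derivM /=; ring.
- move=> c; rewrite /D /E phic deriv_cst alg_hom0 // big1 // => u _.
  by rewrite deriv_cst mulr0.
- move=> w; rewrite /E (bigD1 w) //= deriv_var eqxx mulr1 big1 ?addr0 // => u nu.
  by rewrite deriv_var eq_sym (negbTE nu) mulr0.
Qed.

Lemma map_alg_homM X Y : map_mx psi (X *m Y) = map_mx psi X *m map_mx psi Y.
Proof.
apply/matrixP=> i j; rewrite !mxE alg_hom_sum //; apply: eq_bigr => k _.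
by rewrite !mxE; case: hpsi => _ -> _.
Qed.

Lemma map_alg_homD X Y : map_mx psi (X + Y) = map_mx psi X + map_mx psi Y.
Proof. by apply/matrixP=> i j; rewrite !mxE; case: hpsi => -> _ _. Qed.

Lemma map_alg_homB X Y : map_mx psi (X - Y) = map_mx psi X - map_mx psi Y.
Proof. by apply/matrixP=> i j; rewrite !mxE alg_homB. Qed.

Lemma map_alg_homZ r X : map_mx psi (r *: X) = psi r *: map_mx psi X.
Proof. by apply/matrixP=> i j; rewrite !mxE; case: hpsi => _ -> _. Qed.

Lemma map_alg_hom_sum (I : finType) (F : I -> 'M[ps K s]_2) :
  map_mx psi (\sum_i F i) = \sum_i map_mx psi (F i).
Proof.
apply: (big_morph _ map_alg_homD); apply/matrixP=> i j.
by rewrite !mxE alg_hom0.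
Qed.

(** The chain rule [deriv_transport] expresses the image of a derivative of [C] through the
    derivatives of the image; the coefficients stay in [m] because [psi] preserves it. *)
Lemma tangent_aut C Z : tanord C 0 Z -> tanord (map_mx psi C) 0 (map_mx psi Z).
Proof.
move=> [X [Y [f [_ _ hf ->]]]]; rewrite /tgt !map_alg_homD !map_alg_homM map_alg_hom_sum.
apply: tanordD; first apply: tanordD.
- exact: tanord_left.
- exact: tanord_right.
apply: tanord_sum => v _; rewrite map_alg_homZ.
have -> : map_mx psi (dmx v C) =
    \sum_u psi (ps_deriv v (phi (var K u))) *: dmx u (map_mx psi C).
  apply/matrixP=> i j; rewrite summxE !mxE deriv_transport.
  by apply: eq_bigr => u _; rewrite !mxE.
rewrite scaler_sumr; apply: tanord_sum => u _; rewrite scalerA; apply: tanord_deriv.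
apply: ordgeMr; apply: alg_hom_bij_m (hf v) => //.
by exists phi.
Qed.

End AutTransport.

Lemma finite_codim_equiv A B :
  G_equiv A B -> finite_codim_tangent B -> finite_codim_tangent A.
Proof.
case=> U [V [phi [[U' [UU' U'U]] [V' [VV' V'V]] /Kalg_autP[hphi [psi phiK psiK]] ]]].
move: UU' U'U VV' V'V; rewrite !mx_mulE mx_mapE mx_idE => UU' U'U VV' V'V EB.
have hpsi : alg_hom psi.
  case: hphi => hD hM hc; split=> [f g|f g|c]; apply: (can_inj phiK).
  - by rewrite hD !psiK.
  - by rewrite hM !psiK.
  - by rewrite hc psiK.
move=> /finite_codimE [n [F hF]]; apply/finite_codimE.
(* The inverse group element. It is [K]-linear, since [psi] fixes constants, and maps the tangent
   image of [B] into that of [A]; it therefore carries a finite spanning family along. *)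
pose inv Z := map_mx psi (U' *m Z *m V').
have invE M : inv (U *m map_mx phi M *m V) = M.
  rewrite /inv !mulmxA U'U mul1mx -mulmxA VV' mulmx1.
  by apply/matrixP=> i j; rewrite !mxE phiK.
have invT Z : tanord B 0 Z -> tanord A 0 (inv Z).
  move=> hZ; rewrite -[A]invE -EB; apply: (@tangent_aut phi psi) => //.
  exact: (tangent_conj UU' V'V hZ).
exists n, (fun i => inv (F i)) => M.
have [a ha] := hF (U *m map_mx phi M *m V); exists a.
have -> : M - \sum_i cst s (a i) *: inv (F i) =
  inv (U *m map_mx phi M *m V - \sum_i cst s (a i) *: F i).
  rewrite [inv (_ - _)]/inv mulmxBr mulmxBl map_alg_homB // -/(inv _) invE.
  congr (_ - _).
  rewrite mulmx_sumr mulmx_suml map_alg_hom_sum //; apply: eq_bigr => i _.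
  by rewrite -scalemxAr -scalemxAl map_alg_homZ //; case: hpsi => _ _ ->.
exact: invT.
Qed.

End Transport.

(** * Matrices in general position *)

Section GenericParameters.
Variable K : fieldType.
Implicit Types (t u w z : K) (l : seq K).

(** With [V_t] the matrix [cubic t] defined below: [gdet] is its determinant, [gdisc] the
    discriminant of the characteristic polynomial of [V_u adj(V_t)], and [gtri] the determinant of
    the matrix [P] for which [ell t u w X] is the trace of [P X]. *)
Definition gdet t := t ^+ 2 - t ^+ 4.
Definition gdisc t u := ((t ^+ 2 + u ^+ 2) * (1 - u * t)) ^+ 2 - 4%:R * (gdet t * gdet u).
Definition gtri t u w := (t + u + w) * (t * u * w) - (t * u + t * w + u * w).

Lemma gdiscC t u : gdisc t u = gdisc u t.
Proof. by rewrite /gdisc /gdet; ring. Qed.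

Lemma gtriC t u w : gtri t u w = gtri u t w.
Proof. by rewrite /gtri; ring. Qed.

Lemma gtriCA t u w : gtri t u w = gtri u w t.
Proof. by rewrite /gtri; ring. Qed.

Lemma infinite_nonroot (p : {poly K}) : infinite_type K -> p != 0 ->
  exists t, ~~ root p t.
Proof.
move=> Kinf p0; have [l [ul sl]] : exists l, uniq l /\ size l = size p.
  elim: (size p) => [|n [l [ul <-]]]; first by exists [::].
  by have [x xl] := Kinf l; exists (x :: l); rewrite /= xl.
have : ~~ all (root p) l.
  by apply/negP => h; have := max_poly_roots p0 h ul; rewrite sl ltnn.
by move=> /allPn [t _ ht]; exists t.
Qed.

Definition generic (P : pred K) := [/\ {in P, forall t, gdet t != 0},
  {in P &, forall t u, t != u -> gdisc t u != 0} &
  {in P & &, forall t u w, t != u -> t != w -> u != w -> gtri t u w != 0}].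

(** The conditions on the new parameter [t] are polynomial. Apart from the factor [t^2] of [gdet t],
    they hold at [t = 0], where [gdisc] becomes [u^4] and [gtri] becomes [- u w]. Their product [Q]
    is thus a nonzero polynomial, and the additional factor ['X] excludes the point 0 itself. *)
Lemma generic_extend l : infinite_type K -> generic (mem l) ->
  exists2 t, t \notin l & generic (mem (t :: l)).
Proof.
move=> Kinf [h1 h2 h3].
have l0 u : u \in l -> u != 0.
  by move=> /h1; apply: contraNneq => ->; rewrite /gdet !expr0n subrr.
pose pdisc u : {poly K} := (('X^2 + (u ^+ 2)%:P) * (1 - u%:P * 'X)) ^+ 2
  - (4%:R : K)%:P * (('X^2 - 'X^4) * (gdet u)%:P).
pose ptri u w : {poly K} := ('X + u%:P + w%:P) * ('X * u%:P * w%:P)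
  - ('X * u%:P + 'X * w%:P + u%:P * w%:P).
have discE u t : (pdisc u).[t] = gdisc t u.
  by rewrite /pdisc /gdisc /gdet !(hornerE, horner_exp).
have triE u w t : (ptri u w).[t] = gtri t u w.
  by rewrite /ptri /gtri !(hornerE, horner_exp).
pose Q : {poly K} := (1 - 'X^2) * (\prod_(u <- l) ('X - u%:P) *
  (\prod_(u <- l) pdisc u * \prod_(u <- l) \prod_(w <- l) ptri u w)).
have prod0 (F : K -> {poly K}) t : (\prod_(u <- l) F u).[t] != 0 <->
    {in l, forall u, (F u).[t] != 0}.
  rewrite horner_prod; split; last first.
    by move=> h; rewrite prodf_seq_neq0; apply/allP => u ul; apply/implyP=> _; exact: h.
  by rewrite prodf_seq_neq0 => /allP h u ul; have := h u ul.
have QE t : Q.[t] != 0 <-> [/\ 1 - t ^+ 2 != 0, t \notin l,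
    {in l, forall u, gdisc t u != 0} & {in l &, forall u w, gtri t u w != 0}].
  rewrite /Q !hornerM !mulf_eq0 !negb_or; split.
    move=> /and4P[q1 /prod0 q2 /prod0 q3 /prod0 q4]; split.
    - by move: q1; rewrite !(hornerE, horner_exp).
    - by apply/negP=> /q2; rewrite !hornerE subrr eqxx.
    - by move=> u /q3; rewrite discE.
    - by move=> u w /q4 /prod0 h /h; rewrite triE.
  move=> [q1 q2 q3 q4]; apply/and4P; split.
  - by rewrite !(hornerE, horner_exp).
  - by apply/prod0 => u ul; rewrite !hornerE subr_eq0; apply: contraNneq q2 => ->.
  - by apply/prod0 => u /q3; rewrite discE.
  - by apply/prod0 => u ul; apply/prod0 => w wl; rewrite triE; exact: q4.
have Q0 : Q.[0] != 0.
  apply/QE; split.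
  - by rewrite expr0n subr0 oner_eq0.
  - by apply/negP=> /l0; rewrite eqxx.
  - move=> u /l0 u0; rewrite /gdisc /gdet.
    have -> : ((0 ^+ 2 + u ^+ 2) * (1 - u * 0)) ^+ 2 -
      4%:R * ((0 ^+ 2 - 0 ^+ 4) * (u ^+ 2 - u ^+ 4)) = u ^+ 4 by ring.
    by rewrite expf_neq0.
  - move=> u w /l0 u0 /l0 w0; rewrite /gtri.
    have -> : (0 + u + w) * (0 * u * w) - (0 * u + 0 * w + u * w) = - (u * w) by ring.
    by rewrite oppr_eq0 mulf_neq0.
have XQ : 'X * Q != 0.
  by rewrite mulf_neq0 ?polyX_eq0 //; apply: contraNneq Q0 => ->; rewrite horner0.
have [t] := infinite_nonroot Kinf XQ.
rewrite rootE hornerM hornerX mulf_eq0 negb_or => /andP[t0 /QE[q1 q2 q3 q4]].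
exists t => //; split.
- move=> x; rewrite inE => /predU1P[->|]; last exact: h1.
  have -> : gdet t = t ^+ 2 * (1 - t ^+ 2) by rewrite /gdet; ring.
  by rewrite mulf_neq0 // expf_neq0.
- move=> x y; rewrite !inE => /predU1P[->|xl] /predU1P[->|yl] xy.
  + by rewrite eqxx in xy.
  + exact: q3.
  + by rewrite gdiscC; exact: q3.
  + exact: h2.
- move=> x y z; rewrite !inE => /predU1P[->|xl] /predU1P[->|yl] /predU1P[->|zl] xy xz yz;
    rewrite ?eqxx // in xy xz yz *.
  + exact: q4.
  + by rewrite gtriC; exact: q4.
  + by rewrite -gtriCA; exact: q4.
  + exact: h3.
Qed.

Lemma generic_family s : infinite_type K -> exists t : 'I_s -> K,
  [/\ injective t, forall i, gdet (t i) != 0,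
      forall i j, i != j -> gdisc (t i) (t j) != 0 &
      forall i j k, i != j -> i != k -> j != k -> gtri (t i) (t j) (t k) != 0].
Proof.
move=> Kinf; have [l [sl ul [h1 h2 h3]]] : exists l : seq K,
    [/\ size l = s, uniq l & generic (mem l)].
  elim: s => [|s [l [sl ul gl]]]; first by exists [::].
  have [t tl gt] := generic_extend Kinf gl.
  by exists (t :: l); split; rewrite //= ?sl ?tl.
have tl (i : 'I_s) : l`_i \in l by rewrite mem_nth ?sl.
have tinj (i j : 'I_s) : i != j -> l`_i != l`_j.
  by move=> ij; rewrite nth_uniq ?sl.
exists (fun i => l`_i); split.
- by move=> i j /eqP; apply: contraTeq => /tinj.
- by move=> i; exact: h1.
- by move=> i j ij; apply: h2 => //; exact: tinj.
- by move=> i j k ij ik jk; apply: h3 => //; exact: tinj.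
Qed.

End GenericParameters.

(** * The twisted cubic in the space of 2 x 2 matrices *)

Section TwistedCubic.
Variable K : fieldType.
Implicit Types (t u w z : K) (X C F : 'M[K]_2).

Definition mx2 (a b c d : K) : 'M[K]_2 :=
  \matrix_(i, j) if i == 0 then (if j == 0 then a else b) else (if j == 0 then c else d).

Lemma mx2_eta X : X = mx2 (X 0 0) (X 0 1) (X 1 0) (X 1 1).
Proof.
by apply/matrixP=> -[[|[|//]] hi] -[[|[|//]] hj]; rewrite !mxE /=;
  congr (X _ _); apply/val_inj.
Qed.

Lemma mx2D a b c d a' b' c' d' :
  mx2 a b c d + mx2 a' b' c' d' = mx2 (a + a') (b + b') (c + c') (d + d').
Proof. by apply/matrixP=> i j; rewrite !mxE; case: ifP; case: ifP. Qed.

Lemma mx2N a b c d : - mx2 a b c d = mx2 (- a) (- b) (- c) (- d).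
Proof. by apply/matrixP=> i j; rewrite !mxE; case: ifP; case: ifP. Qed.

Lemma mx2Z x a b c d : x *: mx2 a b c d = mx2 (x * a) (x * b) (x * c) (x * d).
Proof. by apply/matrixP=> i j; rewrite !mxE; case: ifP; case: ifP. Qed.

Lemma mx2M a b c d a' b' c' d' : mx2 a b c d *m mx2 a' b' c' d' =
  mx2 (a * a' + b * c') (a * b' + b * d') (c * a' + d * c') (c * b' + d * d').
Proof.
apply/matrixP=> i j; rewrite !mxE !big_ord_recl big_ord0 addr0 !mxE /=.
by case: ifP; case: ifP.
Qed.

Definition mx2E := (mx2D, mx2N, mx2Z, mx2M).

(* The entries run through the twisted cubic [(1, t, t^2, t^3)], so that any four of
   these matrices form a basis; the placement makes the determinant nonzero. *)
Definition cubic t := mx2 1 t (t ^+ 3) (t ^+ 2).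
Definition cubic_adj t := mx2 (t ^+ 2) (- t) (- t ^+ 3) 1.

Lemma cubic_mul_adj t : cubic t *m cubic_adj t = gdet t *: 1%:M.
Proof.
rewrite (mx2_eta 1%:M) !mxE /= !mx2E /gdet; congr mx2; ring.
Qed.

Lemma cubic_adj_mul t : cubic_adj t *m cubic t = gdet t *: 1%:M.
Proof.
rewrite (mx2_eta 1%:M) !mxE /= !mx2E /gdet; congr mx2; ring.
Qed.

Lemma cubic_mulr_surj t X : gdet t != 0 -> exists F, F *m cubic t = X.
Proof.
move=> gt; exists ((gdet t)^-1 *: (X *m cubic_adj t)).
by rewrite -scalemxAl -mulmxA cubic_adj_mul -scalemxAr mulmx1 scalerA mulVf // scale1r.
Qed.

Definition subspace (W : 'M[K]_2 -> Prop) :=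
  (forall X C, W X -> W C -> W (X + C)) /\ (forall x X, W X -> W (x *: X)).

(* The functional given by the coefficients of [(T - t)(T - u)(T - w)]; it vanishes on
   the three corresponding points of the cubic. *)
Definition ell t u w X : K :=
  X 1 0 - (t + u + w) * X 1 1 + (t * u + t * w + u * w) * X 0 1 - t * u * w * X 0 0.

Lemma cubic_span3 W t u w X : subspace W -> t != u -> t != w -> u != w ->
  W (cubic t) -> W (cubic u) -> W (cubic w) ->
  W (X - ell t u w X *: mx2 0 0 1 0).
Proof.
move=> [WD WZ] tu tw uw ht hu hw.
pose lag x y z := (X 1 1 - (y + z) * X 0 1 + y * z * X 0 0) / ((x - y) * (x - z)).
have -> : X - ell t u w X *: mx2 0 0 1 0 =
  lag t u w *: cubic t + lag u t w *: cubic u + lag w t u *: cubic w.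
  rewrite {1}(mx2_eta X) /ell /cubic !mx2E /lag.
  move: (X 0 0) (X 0 1) (X 1 0) (X 1 1) => a b c d.
  by congr mx2; field; rewrite !subr_eq0 ?tu ?tw ?uw ?(eq_sym u) ?(eq_sym w) ?tu ?tw ?uw.
by apply: (WD); [apply: (WD)|]; apply: WZ.
Qed.

Lemma ell_cubic t u w z : ell t u w (cubic z) = (z - t) * (z - u) * (z - w).
Proof. by rewrite /ell !mxE /=; ring. Qed.

Lemma cubic_span4 W t u w z X : subspace W ->
  t != u -> t != w -> u != w -> t != z -> u != z -> w != z ->
  W (cubic t) -> W (cubic u) -> W (cubic w) -> W (cubic z) -> W X.
Proof.
move=> hW tu tw uw tz uz wz ht hu hw hz; have H Y := cubic_span3 Y hW tu tw uw ht hu hw.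
case: (hW) => WD WZ; have e0 : ell t u w (cubic z) != 0.
  by rewrite ell_cubic !mulf_neq0 // subr_eq0 eq_sym.
have hE : W (mx2 0 0 1 0).
  have hZ : W (ell t u w (cubic z) *: mx2 0 0 1 0).
    have -> : ell t u w (cubic z) *: mx2 0 0 1 0 =
      cubic z + (-1) *: (cubic z - ell t u w (cubic z) *: mx2 0 0 1 0).
      by rewrite scaleN1r opprB addrC subrK.
    by apply: (WD) => //; apply: (WZ); exact: H.
  by have := WZ (ell t u w (cubic z))^-1 _ hZ; rewrite scalerA mulVf // scale1r.
rewrite -(subrK (ell t u w X *: mx2 0 0 1 0) X); apply: (WD); first exact: H.
exact: WZ.
Qed.

Lemma ell_separate t u w : t != u -> t != w -> gtri t u w != 0 ->
  exists C, [/\ ell t u w (C *m cubic t) != 0, ell t u w (C *m cubic u) = 0 &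
                ell t u w (C *m cubic w) = 0].
Proof.
move=> tu tw tri.
(* [ell X = tr (P X)] with [det P = gtri t u w], and [C = adj P *m F] where
   [tr (F (cubic z)) = (z - u)(z - w)]. *)
pose adjP := mx2 (- (t + u + w)) (- 1) (- (t * u + t * w + u * w)) (- (t * u * w)).
pose F := mx2 (u * w) 0 (- (u + w)) 1.
have E z : ell t u w (adjP *m F *m cubic z) = gtri t u w * ((z - u) * (z - w)).
  by rewrite /adjP /F /cubic !mx2E /ell !mxE /= /gtri; ring.
exists (adjP *m F); rewrite !E !subrr mul0r !mulr0; split=> //.
by rewrite !mulf_neq0 // subr_eq0.
Qed.

(* [ad_C ^ 2] is the scalar [disc C] modulo the centraliser [<1, C>]. *)
Lemma ad_square C F : let tau := C 0 0 + C 1 1 in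
  let delta := C 0 0 * C 1 1 - C 0 1 * C 1 0 in
  exists a b : K, (tau ^+ 2 - 4%:R * delta) *: F =
    (C *m (C *m F - F *m C) - (C *m F - F *m C) *m C) + a *: 1%:M + b *: C.
Proof.
move=> tau delta.
pose trF := F 0 0 + F 1 1; pose trCF := (C *m F) 0 0 + (C *m F) 1 1.
exists ((tau ^+ 2 - 2%:R * delta) * trF - tau * trCF), (2%:R * trCF - tau * trF).
rewrite /trCF /trF /tau /delta {tau delta trF trCF}.
rewrite (mx2_eta C) (mx2_eta F) (mx2_eta 1%:M).
move: (C 0 0) (C 0 1) (C 1 0) (C 1 1) (F 0 0) (F 0 1) (F 1 0) (F 1 1).
move=> a b c d e f g h; rewrite !mxE /= !big_ord_recl !big_ord0 !addr0 !mxE /= !mx2E.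
by congr mx2; ring.
Qed.

(** Put [C = V_u adj(V_t)]. Up to the right factor [V_t], the hypotheses provide the image of [ad_C]
    together with [1] and [C]; by [ad_square] these fill the whole matrix space when the
    discriminant of [C] is nonzero. *)
Lemma cubic_span_comm W t u X : subspace W -> gdet t != 0 -> gdisc t u != 0 ->
  W (cubic t) -> W (cubic u) ->
  (forall F, W ((cubic u *m cubic_adj t *m F - F *m (cubic u *m cubic_adj t)) *m cubic t)) ->
  W X.
Proof.
move=> [WD WZ] gt gd ht hu hF; set C := cubic u *m cubic_adj t.
have Ct : C *m cubic t = gdet t *: cubic u.
  by rewrite -mulmxA cubic_adj_mul -scalemxAr mulmx1.
have [F0 F0t] := cubic_mulr_surj X gt.
have [a [b E]] := ad_square C F0.
have dE : (C 0 0 + C 1 1) ^+ 2 - 4%:R * (C 0 0 * C 1 1 - C 0 1 * C 1 0) = gdisc t u.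
  by rewrite /C /cubic /cubic_adj mx2M !mxE /= /gdisc /gdet; ring.
have {}E : gdisc t u *: X = (C *m (C *m F0 - F0 *m C) - (C *m F0 - F0 *m C) *m C) *m cubic t
    + a *: cubic t + (b * gdet t) *: cubic u.
  rewrite -{1}F0t scalemxAl -dE E !mulmxDl -!scalemxAl mul1mx Ct scalerA.
  by rewrite -mulmxDl.
have WX : W (gdisc t u *: X).
  rewrite E; apply: (WD); last exact: WZ.
  by apply: (WD); [exact: hF | exact: WZ].
by have := WZ (gdisc t u)^-1 _ WX; rewrite scalerA mulVf // scale1r.
Qed.

End TwistedCubic.

(** * Perturbations of finite codimension *)

Section Perturbation.
Variables (K : fieldType) (s N : nat) (A : 'M[ps K s]_2) (t : 'I_s -> K).
Hypotheses (degA : mdeglt N A) (N_neq0 : N%:R != 0 :> K).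
Hypotheses (t_inj : injective t) (t_det : forall i, gdet (t i) != 0)
  (t_disc : forall i j, i != j -> gdisc (t i) (t j) != 0)
  (t_tri : forall i j k, i != j -> i != k -> j != k -> gtri (t i) (t j) (t k) != 0).
Implicit Types (M Z : 'M[ps K s]_2) (X C F : 'M[K]_2) (i j k l : 'I_s).

Definition cmx X : 'M[ps K s]_2 := map_mx (@cst K s) X.

Definition vpow i : ps K s := var K i ^+ N.

Definition perturbed : 'M[ps K s]_2 := A + \sum_l vpow l *: cmx (cubic (t l)).

Local Notation B := perturbed.
Local Notation y := vpow.
Local Notation V i := (cubic (t i)).

Lemma mdegltD n M Z : mdeglt n M -> mdeglt n Z -> mdeglt n (M + Z).
Proof. by move=> h1 h2 a b; rewrite mxE; apply: degltD. Qed.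

Lemma mdegltZ n m r M : deglt n.+1 r -> mdeglt m M -> mdeglt (n + m) (r *: M).
Proof. by move=> h1 h2 a b; rewrite mxE; apply: degltM. Qed.

Lemma mdegltN n M : mdeglt n M -> mdeglt n (- M).
Proof. by move=> h a b; rewrite mxE; apply: degltN. Qed.

Lemma mdeglt_cmxl n X M : mdeglt n M -> mdeglt n (cmx X *m M).
Proof.
move=> h a b; rewrite mxE; apply: deglt_sum => c _; rewrite -[n]add0n mxE.
by apply: degltM => //; exact: deglt_cst.
Qed.

Lemma mdeglt_cmxr n X M : mdeglt n M -> mdeglt n (M *m cmx X).
Proof.
move=> h a b; rewrite mxE; apply: deglt_sum => c _; rewrite -[n]add0n [cmx X _ _]mxE mulrC.
by apply: degltM => //; exact: deglt_cst.
Qed.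

(* [reduces n M]: modulo the tangent image, [M] has degree less than [n].  For [M]
   homogeneous of degree [n] this says that [M] lies in the module of top-degree forms. *)
Definition reduces n M := exists2 Z, tanord B 0 Z & mdeglt n (M - Z).

Lemma reducesD n M M' : reduces n M -> reduces n M' -> reduces n (M + M').
Proof.
move=> [Z hZ h] [Z' hZ' h']; exists (Z + Z'); first exact: tanordD.
by rewrite opprD addrACA; exact: mdegltD.
Qed.

Lemma reducesZ n m r M : deglt n.+1 r -> reduces m M -> reduces (n + m) (r *: M).
Proof.
move=> hr [Z hZ h]; exists (r *: Z); first exact: tanordZ0.
by rewrite -scalerBr; exact: mdegltZ.
Qed.

Lemma reduces_cst n c M : reduces n M -> reduces n (cst s c *: M).
Proof. by move=> h; rewrite -[n]add0n; apply: reducesZ => //; exact: deglt_cst. Qed.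

Lemma reducesN n M : reduces n M -> reduces n (- M).
Proof.
by move=> h; rewrite -scaleN1r -(rmorph1 (@cst K s)) -rmorphN; exact: reduces_cst.
Qed.

Lemma reducesB n M M' : reduces n M -> reduces n M' -> reduces n (M - M').
Proof. by move=> h h'; apply: reducesD => //; exact: reducesN. Qed.

Lemma reduces_deglt n M : mdeglt n M -> reduces n M.
Proof. by move=> h; exists 0; [exact: tanord0 | rewrite subr0]. Qed.

Lemma reduces0 n : reduces n 0.
Proof. by apply: reduces_deglt => a b; rewrite mxE; exact: deglt_0. Qed.

Lemma reduces_sum n (I : Type) (r : seq I) (P : pred I) (F : I -> 'M[ps K s]_2) :
  (forall x, P x -> reduces n (F x)) -> reduces n (\sum_(x <- r | P x) F x).
Proof.
move=> h; elim/big_rec: _ => [|x M Px hM]; first exact: reduces0.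
by apply: reducesD => //; exact: h.
Qed.

Lemma reduces_restrict n (P : pred 'I_s) (F : 'I_s -> 'M[ps K s]_2) :
  (forall l, ~~ P l -> reduces n (F l)) -> reduces n (\sum_l F l) ->
  reduces n (\sum_(l | P l) F l).
Proof.
move=> h; rewrite (bigID P) /= => H.
rewrite -(addrK (\sum_(l | ~~ P l) F l) (\sum_(l | P l) F l)).
by apply: reducesB => //; apply: reduces_sum.
Qed.

Lemma deglt_vpow i : deglt N.+1 (y i).
Proof. exact: deglt_varX. Qed.

Lemma reduces_vpow n i M : reduces n M -> reduces (N + n) (y i *: M).
Proof. by move=> h; apply: reducesZ => //; exact: deglt_vpow. Qed.

Lemma cmxD X C : cmx (X + C) = cmx X + cmx C.
Proof. exact: map_mxD. Qed.

Lemma cmxZ c X : cmx (c *: X) = cst s c *: cmx X.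
Proof. exact: map_mxZ. Qed.

Lemma cmxM X C : cmx (X *m C) = cmx X *m cmx C.
Proof. exact: map_mxM. Qed.

Lemma subspace_reduces n p : subspace (fun X => reduces n (p *: cmx X)).
Proof.
split=> [X C hX hC|c X hX]; first by rewrite cmxD scalerDr; exact: reducesD.
by rewrite cmxZ scalerA mulrC -scalerA; exact: reduces_cst.
Qed.

Lemma dmx_cmx v p X : dmx v (p *: cmx X) = ps_deriv v p *: cmx X.
Proof.
by apply/matrixP=> a b; rewrite !mxE derivM deriv_cst mulr0 addr0.
Qed.

Lemma dmx_sum v (I : finType) (F : I -> 'M[ps K s]_2) :
  dmx v (\sum_x F x) = \sum_x dmx v (F x).
Proof.
apply: (big_morph _ (dmxD v)); apply/matrixP=> a b; rewrite !mxE.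
by rewrite -(rmorph0 (@cst K s)) deriv_cst rmorph0.
Qed.

(** The vector field [x_i d/dx_i] sees only the [i]-th term of the perturbation and multiplies it by
    [N], which is invertible; applied to [A] it does not raise the degree. *)
Lemma reduces_euler i : reduces N (y i *: cmx (V i)).
Proof.
have N0 : (0 < N)%N by rewrite lt0n; apply: contraNneq N_neq0 => ->.
have E : var K i *: dmx i B = var K i *: dmx i A + (cst s N%:R * y i) *: cmx (V i).
  rewrite /perturbed dmxD dmx_sum scalerDr; congr (_ + _).
  rewrite (bigD1 i) //= [X in _ + X]big1 ?addr0 => [|l li].
    rewrite dmx_cmx scalerA /vpow derivX deriv_var eqxx mul1r mulrnAr -exprS prednK //.
    by rewrite rmorph_nat mulr_natl.
  by rewrite dmx_cmx /vpow derivX deriv_var (negbTE li) mul0r mul0rn scale0r.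
exists (cst s N%:R^-1 *: (var K i *: dmx i B)).
  by apply: tanordZ0; apply: tanord_deriv; exact: ordge_var.
rewrite E scalerDr !scalerA mulrA -rmorphM mulVf // rmorph1 mul1r opprD addrC subrK.
apply: mdegltN => a b; rewrite !mxE -[N]add0n -mulrA; apply: degltM; first exact: deglt_cst.
rewrite -[N]prednK // -add1n; apply: degltM; first exact: deglt_varX 1.
exact: deglt_deriv.
Qed.

Lemma reduces_left C : reduces N (\sum_l y l *: cmx (C *m V l)).
Proof.
exists (cmx C *m B); first exact: tanord_left.
rewrite /perturbed mulmxDr mulmx_sumr opprD addrCA.
under [X in _ - X]eq_bigr => l _ do rewrite -scalemxAr -cmxM.
by rewrite subrr addr0; apply: mdegltN; exact: mdeglt_cmxl.
Qed.

Lemma reduces_right C : reduces N (\sum_l y l *: cmx (V l *m C)).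
Proof.
exists (B *m cmx C); first exact: tanord_right.
rewrite /perturbed mulmxDl mulmx_suml opprD addrCA.
under [X in _ - X]eq_bigr => l _ do rewrite -scalemxAl -cmxM.
by rewrite subrr addr0; apply: mdegltN; exact: mdeglt_cmxr.
Qed.

Section Relations.
Variables (p : ps K s) (P : pred 'I_s).
Hypothesis degp : deglt (N * 3).+1 p.
Hypothesis killed : forall l X, ~~ P l -> reduces (N * 4) ((p * y l) *: cmx X).

Lemma reduces_left_on C : reduces (N * 4) (\sum_(l | P l) (p * y l) *: cmx (C *m V l)).
Proof.
apply: reduces_restrict => [l|]; first exact: killed.
have -> : (N * 4 = N * 3 + N)%N by lia.
have := reducesZ degp (reduces_left C); rewrite scaler_sumr.
by under eq_bigr => l _ do rewrite scalerA.
Qed.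

Lemma reduces_right_on C : reduces (N * 4) (\sum_(l | P l) (p * y l) *: cmx (V l *m C)).
Proof.
apply: reduces_restrict => [l|]; first exact: killed.
have -> : (N * 4 = N * 3 + N)%N by lia.
have := reducesZ degp (reduces_right C); rewrite scaler_sumr.
by under eq_bigr => l _ do rewrite scalerA.
Qed.

End Relations.

Lemma deglt_vpow3 i j k : deglt (N * 3).+1 (y i * y j * y k).
Proof.
have -> : (N * 3).+1 = (N + (N + N.+1))%N by lia.
by rewrite -mulrA; do 2 (apply: degltM; first exact: deglt_vpow); exact: deglt_vpow.
Qed.

Lemma t_neq i j : i != j -> t i != t j.
Proof. by apply: contra_neq => /t_inj. Qed.

Lemma reduces_cubic3 i j k : reduces (N * 3) (y i * y j * y k *: cmx (V i)).
Proof.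
have -> : y i * y j * y k *: cmx (V i) = y k *: (y j *: (y i *: cmx (V i))).
  by rewrite !scalerA; congr (_ *: _); ring.
have -> : (N * 3 = N + (N + N))%N by lia.
by do 2 apply: reduces_vpow; exact: reduces_euler.
Qed.

Lemma reduces_cubic4 i j k l : reduces (N * 4) ((y i * y j * y k * y l) *: cmx (V i)).
Proof.
rewrite mulrC -scalerA; have -> : (N * 4 = N + N * 3)%N by lia.
by apply: reduces_vpow; exact: reduces_cubic3.
Qed.

Lemma reduces4 i j k l X : i != j -> i != k -> j != k -> i != l -> j != l -> k != l ->
  reduces (N * 4) ((y i * y j * y k * y l) *: cmx X).
Proof.
move=> ij ik jk il jl kl.
apply: (cubic_span4 (t := t i) (u := t j) (w := t k) (z := t l) X
  (subspace_reduces (N * 4) (y i * y j * y k * y l))); rewrite ?t_neq //.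
- exact: reduces_cubic4.
- have -> : y i * y j * y k * y l = y j * y i * y k * y l by ring.
  exact: reduces_cubic4.
- have -> : y i * y j * y k * y l = y k * y j * y i * y l by ring.
  exact: reduces_cubic4.
- have -> : y i * y j * y k * y l = y l * y j * y k * y i by ring.
  exact: reduces_cubic4.
Qed.

(** Modulo [V_i], [V_j], [V_k] only the line of [e] survives. In the left relation multiplied by
    [p], the products with four distinct factors drop out, and [ell_separate] provides a multiplier
    [C] that removes the [j] and [k] terms along [e] but keeps the [i] term. *)
Lemma reduces3 i j k X : i != j -> i != k -> j != k ->
  reduces (N * 4) ((y i * y j * y k * y i) *: cmx X).
Proof.
move=> ij ik jk; set p := y i * y j * y k; pose e : 'M[K]_2 := mx2 0 0 1 0.
pose L := ell (t i) (t j) (t k).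
have mod_e l Y : reduces (N * 4) ((p * y l) *: cmx (Y - L Y *: e)).
  rewrite mulrC -scalerA; have -> : (N * 4 = N + N * 3)%N by lia.
  apply: reduces_vpow; apply: (cubic_span3 Y (subspace_reduces (N * 3) p));
    rewrite ?t_neq //.
  - exact: reduces_cubic3.
  - have -> : p = y j * y i * y k by rewrite /p; ring.
    exact: reduces_cubic3.
  - have -> : p = y k * y j * y i by rewrite /p; ring.
    exact: reduces_cubic3.
have [C [Ci Cj Ck]] := ell_separate (t_neq ij) (t_neq ik) (t_tri ij ik jk).
pose P l := [|| l == i, l == j | l == k].
have H : reduces (N * 4) (\sum_(l | P l) (p * y l) *: cmx (C *m V l)).
  apply: reduces_left_on => [|l Y]; first exact: deglt_vpow3.
  rewrite /P !negb_or => /and3P[li lj lk].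
  by apply: reduces4; rewrite // eq_sym.
have {}H : reduces (N * 4) (\sum_(l | P l) (p * y l) *: cmx (L (C *m V l) *: e)).
  have -> : \sum_(l | P l) (p * y l) *: cmx (L (C *m V l) *: e) =
    \sum_(l | P l) (p * y l) *: cmx (C *m V l) -
    \sum_(l | P l) (p * y l) *: cmx (C *m V l - L (C *m V l) *: e).
    rewrite -sumrB; apply: eq_bigr => l _; rewrite -scalerBr; congr (_ *: _).
    by rewrite -map_mxB; congr cmx; rewrite opprB addrC subrK.
  by apply: reducesB; [exact: H | apply: reduces_sum => l _; exact: mod_e].
have He : reduces (N * 4) ((p * y i) *: cmx e).
  move: H; rewrite (bigD1 i) /= ?/P ?eqxx // big1 ?addr0 => [H|l]; last first.
    move=> /andP[/or3P[/eqP->|/eqP->|/eqP->]]; rewrite ?eqxx // => _.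
      by rewrite /L Cj scale0r /cmx map_mx0 scaler0.
    by rewrite /L Ck scale0r /cmx map_mx0 scaler0.
  have [_ WZ] := subspace_reduces (N * 4) (p * y i).
  have := WZ (L (C *m V i))^-1 _ H; rewrite scalerA (mulVf Ci) scale1r; exact.
have [WD WZ] := subspace_reduces (N * 4) (p * y i).
rewrite -(subrK (L X *: e) X); apply: (WD); first exact: mod_e.
exact: (WZ).
Qed.

(** The left and right relations are combined: with right multiplier [adj(V_i) F V_i], their
    [p * y i] terms become proportional and cancel. What remains at [p * y j], that is
    [y_i^2 y_j^2], is a commutator, so [cubic_span_comm] applies there. The left relation then
    carries the result over to [p * y i]. *)
Lemma reduces2 i j X : i != j -> reduces (N * 4) ((y i * y j * y i * y i) *: cmx X).
Proof.
move=> ij; set p := y i * y j * y i; pose P l := (l == i) || (l == j).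
have kill l Y : ~~ P l -> reduces (N * 4) ((p * y l) *: cmx Y).
  rewrite negb_or => /andP[li lj].
  have -> : p * y l = y i * y j * y l * y i by rewrite /p; ring.
  by apply: reduces3; rewrite // eq_sym.
have two (F : 'I_s -> 'M[ps K s]_2) : \sum_(l | P l) F l = F i + F j.
  rewrite (bigD1 i) /= ?/P ?eqxx // (bigD1 j) /= ?eqxx ?orbT ?(eq_sym j) ?ij //.
  rewrite big1 ?addr0 // => l /andP[/andP[/orP[/eqP->|/eqP->]]]; rewrite ?eqxx //.
have degp : deglt (N * 3).+1 p by exact: deglt_vpow3.
have HL F : reduces (N * 4)
    ((p * y i) *: cmx (F *m V i) + (p * y j) *: cmx (F *m V j)).
  by rewrite -(two (fun l => (p * y l) *: cmx (F *m V l))); exact: reduces_left_on.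
have HR F : reduces (N * 4)
    ((p * y i) *: cmx (V i *m F) + (p * y j) *: cmx (V j *m F)).
  by rewrite -(two (fun l => (p * y l) *: cmx (V l *m F))); exact: reduces_right_on.
have Hj Y : reduces (N * 4) ((p * y j) *: cmx Y).
  apply: (cubic_span_comm Y (subspace_reduces (N * 4) (p * y j)) (t_det i) (t_disc ij)).
  - have -> : p * y j = y i * y i * y j * y j by rewrite /p; ring.
    exact: reduces_cubic4.
  - have -> : p * y j = y j * y i * y j * y i by rewrite /p; ring.
    exact: reduces_cubic4.
  move=> F; set C := V j *m cubic_adj (t i).
  have -> : (p * y j) *: cmx ((C *m F - F *m C) *m V i) =
     ((p * y i) *: cmx (V i *m (cubic_adj (t i) *m F *m V i)) +
      (p * y j) *: cmx (V j *m (cubic_adj (t i) *m F *m V i))) -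
     cst s (gdet (t i)) *:
       ((p * y i) *: cmx (F *m V i) + (p * y j) *: cmx (F *m V j)).
    have -> : V i *m (cubic_adj (t i) *m F *m V i) = gdet (t i) *: (F *m V i).
      by rewrite !mulmxA cubic_mul_adj -!scalemxAl mul1mx.
    have CV : C *m V i = gdet (t i) *: V j.
      by rewrite -mulmxA cubic_adj_mul -scalemxAr mulmx1.
    have -> : (C *m F - F *m C) *m V i =
        V j *m (cubic_adj (t i) *m F *m V i) - gdet (t i) *: (F *m V j).
      by rewrite mulmxBl -(mulmxA F) CV -scalemxAr /C !mulmxA.
    rewrite /cmx map_mxB -!/(cmx _) !cmxZ scalerBr scalerDr !scalerA.
    rewrite opprD addrACA [cst s _ * (p * y i)]mulrC subrr add0r.
    by rewrite [cst s _ * (p * y j)]mulrC.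
  by apply: reducesB; [exact: HR | apply: reduces_cst; exact: HL].
have [F <-] := cubic_mulr_surj X (t_det i).
rewrite -[_ *: _](addrK ((p * y j) *: cmx (F *m V j))).
by apply: reducesB; [exact: HL | exact: Hj].
Qed.

(** Multiplied by [y_i^3], the left relation retains only its [i]-th term, and [V_i] is
    invertible. *)
Lemma reduces1 i X : reduces (N * 4) (var K i ^+ (N * 4) *: cmx X).
Proof.
have -> : var K i ^+ (N * 4) = y i * y i * y i * y i :> ps K s.
  by rewrite exprM -/(y i); ring.
have [F <-] := cubic_mulr_surj X (t_det i).
have := @reduces_left_on (y i * y i * y i) (pred1 i) (deglt_vpow3 i i i) _ F.
rewrite big_pred1_eq; apply=> l Y li.
have -> : y i * y i * y i * y l = y i * y l * y i * y i by ring.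
by apply: reduces2; rewrite eq_sym.
Qed.

Lemma reduces_poly n M : mdeglt n M -> reduces (s * (N * 4)).+1 M.
Proof.
set D := (N * 4)%N; elim: n M => [|n IH] M hM.
  by apply: reduces_deglt => a b; apply: deglt_le (hM a b).
case: (ltnP n (s * D).+1) => nD.
  by apply: reduces_deglt => a b; apply: deglt_le (hM a b).
suff [Z hZ /IH [Z' hZ' h]] : reduces n M.
  exists (Z + Z'); first exact: tanordD.
  by rewrite opprD addrA.
rewrite (matrix_sum_delta M); apply: reduces_sum => a _; apply: reduces_sum => b _.
rewrite -(subrK (trunc n (M a b)) (M a b)) scalerDl; apply: reducesD; last first.
  apply: reduces_deglt => c d; rewrite mxE mulrC mxE.
  case: (_ && _); rewrite ?mul1r ?mul0r; last exact: deglt_0.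
  exact: deglt_trunc.
(* [f] is the homogeneous part of degree [n]; as [n] exceeds [s * D], each of its monomials is
   divisible by some [x_v^D]. *)
set f := _ - _.
have hf : deglt n.+1 f.
  apply: degltD; first exact: hM.
  by apply: degltN; apply: deglt_le (@deglt_trunc _ _ n _).
have [c|g [E _ hg]] := @split_vars _ _ D f.
  move=> h; apply: exists_large_exponent; apply: (leq_trans nD).
  by rewrite leqNgt; apply: contra h => h; rewrite /f ordge_trunc.
rewrite E scaler_suml; apply: reduces_sum => v _; rewrite mulrC -scalerA.
have Dn : (D <= n)%N.
  apply: leq_trans nD; apply: leqW; apply: leq_pmull.
  by case: (s) v => [[]|].
rewrite -[n in reduces n _](subnK Dn); apply: reducesZ.
  by rewrite -subSn //; exact: hg.
have -> : delta_mx a b = cmx (delta_mx a b) :> 'M[ps K s]_2 by rewrite /cmx map_delta_mx.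
exact: reduces1.
Qed.

(** [reduces_poly] covers polynomial matrices only, so it does not bound the codimension over power
    series directly. It does place all multiples of a matrix unit by powers of [x_v] in one
    finite-dimensional space modulo the tangent image, as [tangent_var_power] requires. *)
Lemma perturbed_finite_codim : finite_codim_tangent B.
Proof.
have [n [F hF]] := @mdeglt_span K s (s * (N * 4)).+1.
have [D hD] : exists D, cofinal B D.
  apply: cofinal_uniform => v a b; apply: (@tangent_var_power _ _ _ n F) => m.
  have [Z hZ /hF [c hc]] : reduces (s * (N * 4)).+1 (var K v ^+ m *: delta_mx a b).
    apply: (@reduces_poly m.+1) => i j; rewrite !mxE.
    case: (_ && _); rewrite ?mulr1 ?mulr0; [exact: deglt_varX | exact: deglt_0].
  by exists c; rewrite -hc opprB addrC subrK.
exact: cofinal_finite_codim hD.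
Qed.

End Perturbation.

Theorem theorem1p2 (K : fieldType) (s : nat) (A : M22 K s) :
  infinite_type K ->
  (forall i j, in_m (A i j)) ->
  (G_finitely_determined A <-> finite_codim_tangent A).
Proof.
move=> Kinf Am; split=> [[k [_ det_k]]|/finite_codim_cofinal [D hD]]; last first.
  by apply: cofinal_determined hD => i j; apply/in_mE; exact: Am.
(* Two consecutive integers cannot both vanish in [K]. *)
have [N kN N0] : exists2 N, (k < N)%N & N%:R != 0 :> K.
  case: (eqVneq (k.+1%:R : K) 0) => [E|]; last by exists k.+1.
  by exists k.+2; rewrite // -natr1 E add0r oner_eq0.
have [t [t_inj t_det t_disc t_tri]] := generic_family s Kinf.
pose A' := map_mx (trunc k.+1) A.
have degA' : mdeglt N A'.
  by move=> i j; rewrite mxE; apply: deglt_le (@deglt_trunc _ _ k.+1 _).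
(* It remains to see that the perturbed matrix differs from [A] by order at least [k + 1]: the
   truncation keeps all degrees up to [k], and [N > k]. *)
apply: finite_codim_equiv (perturbed_finite_codim degA' N0 t_inj t_det t_disc t_tri).
apply: det_k => i j; apply/in_mpowE; rewrite mx_subE /perturbed addrAC.
rewrite !mxE summxE; apply: ordgeD.
  by rewrite -opprB; apply: ordgeN; exact: ordge_trunc.
apply: ordge_sum => l _; rewrite !mxE; apply: ordgeMr; apply: ordge_le kN _.
exact/ordgeX/ordge_var.
Qed.
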